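(* Let $X$ be a biquandle with a distinguished element $x_0$, let $R$ be a commutative ring with unity, and let $\beta=(A,B)$ be an $X$-bracket with values in $R$. Let $f$ be an $X$-coloring of (a diagram of) an oriented link $L$. Then $$\mathcal{H}_\beta(f)\;\cong\;\mathrm{Kh}_\beta(L)\{Z_\beta(f)\}$$ as sequences (indexed by $i\in\mathbb{Z}$) of $R^\times$-graded modules, where the grading shift is given by the formal sum $$Z_\beta(f)=\left(\prod_{\tau^+}A_{x_\tau,y_\tau}A_{x_0,x_0}^{-1}\right)\left(\prod_{\tau^-}B_{x_\tau,y_\tau}^{-1}B_{x_0,x_0}\right)\cdot\mathrm{gdim}(S),$$ with $\tau^+$ (respectively $\tau^-$) ranging over the positive (respectively negative) crossings of the diagram.
   Context: **Biquandles.** A biquandle is a set $X$ with two binary operations $\underline{\rhd},\overline{\rhd}$ such that for all $x,y,z\in X$: (i) $x\,\underline{\rhd}\,x=x\,\overline{\rhd}\,x$; (ii) the maps $\alpha_y(x)=x\,\overline{\rhd}\,y$, $\beta_y(x)=x\,\underline{\rhd}\,y$ and $S(x,y)=(y\,\overline{\rhd}\,x,\;x\,\underline{\rhd}\,y)$ are invertible; (iii) $(x\underline{\rhd}y)\underline{\rhd}(z\underline{\rhd}y)=(x\underline{\rhd}z)\underline{\rhd}(y\overline{\rhd}z)$, $(x\underline{\rhd}y)\overline{\rhd}(z\underline{\rhd}y)=(x\overline{\rhd}z)\underline{\rhd}(y\overline{\rhd}z)$, $(x\overline{\rhd}y)\overline{\rhd}(z\overline{\rhd}y)=(x\overline{\rhd}z)\overline{\rhd}(y\underline{\rhd}z)$.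 **Colorings.** An $X$-coloring of an oriented link diagram assigns an element of $X$ to each semiarc (edge between consecutive crossing points, counting over- and under-passages) so that the following holds at each crossing $\tau$. Draw $\tau$ with both strands pointing downwards; let $x_\tau$ be the color of the left semiarc belonging to the under-strand and $y_\tau$ the color of the left semiarc belonging to the over-strand. Then the right semiarc of the under-strand has color $x_\tau\,\underline{\rhd}\,y_\tau$ and the right semiarc of the over-strand has color $y_\tau\,\overline{\rhd}\,x_\tau$. (At a positive crossing the left under-semiarc is at the top left and the left over-semiarc at the bottom left; at a negative crossing these positions are exchanged.) **Biquandle brackets.** An $X$-bracket with values in a commutative unital ring $R$ is a pair of maps $A,B:X\times X\to R^\times$ (written $A_{x,y},B_{x,y}$) together with $\delta\in R$, $w\in R^\times$ such that for all $x,y,z\in X$: (i) $w=-A_{x,x}^2B_{x,x}^{-1}$; (ii) $\delta=-A_{x,y}B_{x,y}^{-1}-A_{x,y}^{-1}B_{x,y}$; (iii) $$A_{x,y}A_{y,z}A_{x\underline{\rhd}y,z\overline{\rhd}y}=A_{x,z}A_{y\overline{\rhd}x,z\overline{\rhd}x}A_{x\underline{\rhd}z,y\underline{\rhd}z},$$ $$A_{x,y}B_{y,z}B_{x\underline{\rhd}y,z\overline{\rhd}y}=B_{x,z}B_{y\overline{\rhd}x,z\overline{\rhd}x}A_{x\underline{\rhd}z,y\underline{\rhd}z},$$ $$B_{x,y}A_{y,z}B_{x\underline{\rhd}y,z\overline{\rhd}y}=B_{x,z}A_{y\overline{\rhd}x,z\overline{\rhd}x}B_{x\underline{\rhd}z,y\underline{\rhd}z},$$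 $$A_{x,y}A_{y,z}B_{x\underline{\rhd}y,z\overline{\rhd}y}=A_{x,z}B_{y\overline{\rhd}x,z\overline{\rhd}x}A_{x\underline{\rhd}z,y\underline{\rhd}z}+A_{x,z}A_{y\overline{\rhd}x,z\overline{\rhd}x}B_{x\underline{\rhd}z,y\underline{\rhd}z}+\delta A_{x,z}B_{y\overline{\rhd}x,z\overline{\rhd}x}B_{x\underline{\rhd}z,y\underline{\rhd}z}+B_{x,z}B_{y\overline{\rhd}x,z\overline{\rhd}x}B_{x\underline{\rhd}z,y\underline{\rhd}z},$$ $$B_{x,z}A_{y\overline{\rhd}x,z\overline{\rhd}x}A_{x\underline{\rhd}z,y\underline{\rhd}z}=B_{x,y}A_{y,z}A_{x\underline{\rhd}y,z\overline{\rhd}y}+A_{x,y}B_{y,z}A_{x\underline{\rhd}y,z\overline{\rhd}y}+\delta B_{x,y}B_{y,z}A_{x\underline{\rhd}y,z\overline{\rhd}y}+B_{x,y}B_{y,z}B_{x\underline{\rhd}y,z\overline{\rhd}y}.$$ **Graded modules.** For an abelian group $H$, an $H$-graded ring is a ring $S=\bigoplus_{h\in H}S_h$ (as additive groups) with $S_gS_h\subset S_{gh}$; an $H$-graded $S$-module is an $S$-module $M=\bigoplus_{h\in H}M_h$ (additive groups) with $S_gM_h\subset M_{gh}$. Direct sums and tensor products over $S$ carry the usual $H$-gradings. $M\{h\}$ is the same module with an element of degree $g$ in $M$ given degree $hg$; for a formal sum of group elements with $I\subset H$, $M\{\sum_{h\in I}h\}=\bigoplus_{h\in I}M\{h\}$.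 The graded dimension is the formal sum $\mathrm{gdim}(M)=\sum_{h\in H}\mathrm{rank}_{\mathbb{Z}}(M_h)\cdot h$. Shifts $\{\cdot\}$ apply termwise to sequences and complexes, and $C[j]^i=C^{i-j}$. **The ring $S$ and algebra $M$.** Put $q_{x,y}=-A_{x,y}^{-1}B_{x,y}$, $q=q_{x_0,x_0}$, $G=\langle q_{x,y}^{-1}q: x,y\in X\rangle\le R^\times$, and let $S=\mathbb{Z}[G]$ be the group ring with $R^\times$-grading $\deg(g)=g$ for $g\in G$ (so $\mathrm{gdim}(S)=\sum_{g\in G}g$, and for $c\in R^\times$, $c\cdot\mathrm{gdim}(S)=\sum_{g\in G}cg$, a formal sum of elements of $R^\times$). Let $M=S[t]/(t^2)$ be the $R^\times$-graded $S$-module with $\deg(1)=q$, $\deg(t)=q^{-1}$ (so $\deg(g\cdot 1)=gq$, $\deg(gt)=gq^{-1}$), with $S$-linear maps $m:M\otimes M\to M$, $1\otimes1\mapsto1$, $1\otimes t\mapsto t$, $t\otimes1\mapsto t$, $t\otimes t\mapsto0$, and $\Delta:M\to M\otimes M$, $1\mapsto1\otimes t+t\otimes1$, $t\mapsto t\otimes t$ (tensor products over $S$). **The complex and $\mathcal{H}_\beta(f)$.** Let $f$ be an $X$-coloring of a diagram with crossings $1,\dots,n$, of which $n_+$ are positive and $n_-$ negative. With strands pointing down, each crossing can be smoothed vertically (the orientation-respecting smoothing) or horizontally. The 0-smoothing of a positive crossing is vertical, with coefficient $A_{x_\tau,y_\tau}$, and its 1-smoothing is horizontal, with coefficient $B_{x_\tau,y_\tau}$;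 the 0-smoothing of a negative crossing is horizontal, with coefficient $B_{x_\tau,y_\tau}^{-1}$, and its 1-smoothing is vertical, with coefficient $A_{x_\tau,y_\tau}^{-1}$. To each vertex $v\in\{0,1\}^n$ with $|v|$ ones, whose smoothing has $k$ circles, assign $M^{\otimes k}$ (one tensor factor per circle) with grading shifted by $(-1)^{|v|}$ times the product of the coefficients. To each edge changing the smoothing of crossing $\tau$ from 0 to 1, assign $q\,q_{x_\tau,y_\tau}^{-1}$ times $m$ (if two circles merge) or $\Delta$ (if one circle splits) applied to the tensor factors involved (identity on the others), with the usual sign $(-1)^{\#\{\text{ones of } v \text{ before the changed position}\}}$ making the faces anticommute. Let $\tilde C_\beta^i(f)$ be the direct sum over vertices with $|v|=i$, with differential the sum of the edge maps. Set $C_\beta(f)=\tilde C_\beta(f)[-n_-]\{(-1)^{n_-}w^{n_--n_+}\}$, where $w=-A_{x_0,x_0}^2B_{x_0,x_0}^{-1}$; this is a cochain complex of $R^\times$-graded $S$-modules with degree-preserving differentials. $\mathcal{H}_\beta(f)$ is the sequence of its cohomology modules, with induced $R^\times$-gradings. **$\mathrm{Kh}_\beta(L)$.** $\mathrm{Kh}(L)$ is the integral Khovanov homology of $L$, a sequence (indexed by homological degree $i\in\mathbb{Z}$) of $\mathbb{Z}$-graded $\mathbb{Z}$-modules, in the normalization (Bar-Natan's) in which the cube complex, built over $\mathbb{Z}$ with $\deg 1=1$, $\deg t=-1$ and vertex shift $|v|$, is finally shifted by $[-n_-]$ homologically and by $n_+-2n_-$ in the quantum grading. $\mathrm{Kh}_\beta(L)$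 is $\mathrm{Kh}(L)$ regarded as a sequence of $R^\times$-graded $\mathbb{Z}$-modules via the homomorphism $\mathbb{Z}\to R^\times$, $1\mapsto q$: the degree-$r$ part is the direct sum of the degree-$k$ parts of $\mathrm{Kh}(L)$ over all $k$ with $q^k=r$. Since $\mathrm{Kh}_\beta(L)$ consists of $\mathbb{Z}$-modules, the isomorphism in the claim is one of $R^\times$-graded $\mathbb{Z}$-modules in each index $i$. *)

(* Defs.v *)
From HB Require Import structures.
From mathcomp Require Import all_boot perm all_algebra ring_quotient.
From mathcomp Require Import finmap boolp.
From mathcomp.multinomials Require Import monalg.

Set Implicit Arguments.
Unset Strict Implicit.
Unset Printing Implicit Defensive.

Import GRing.Theory.
Local Open Scope ring_scope.

HB.mixin Record Group_isAbelian H of monoid.Group H := {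
  abmulgC : commutative (@monoid.mul H)
}.
#[short(type="abelianGroupType")]
HB.structure Definition AbelianGroup := {H of monoid.Group H & Group_isAbelian H}.

Definition expgz (H : groupType) (g : H) (k : int) : H :=
  match k with Posz n => (g ^+ n)%g | Negz n => (g ^- n.+1)%g end.

(* The group of units R^x; a unit is stored together with its inverse, so R
   need not have decidable units and may be the zero ring. *)
Section Units.
Variable R : comPzRingType.

Record units := Units { units_val : R * R; _ : units_val.1 * units_val.2 == 1 }.
HB.instance Definition _ := [isSub for units_val].
HB.instance Definition _ := [Choice of units by <:].

Definition uval (u : units) : R := (units_val u).1.

Lemma units_mulP (u : units) : uval u * (units_val u).2 = 1.
Proof. by case: u => -[a b] ab; apply/eqP. Qed.

Lemma uval_inj : injective uval.
Proof.
move=> u v; have := units_mulP u; have := units_mulP v.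
case: u v => -[a b] iab [[c d] icd]; rewrite /uval /= => cd ab ac.
apply/val_inj => /=; congr pair => //.
by rewrite -[b]mulr1 -cd -ac mulrCA mulrA ab mul1r.
Qed.

Fact uone_subproof : (1 : R) * 1 == 1. Proof. by rewrite mulr1. Qed.
Definition uone : units := @Units (1, 1) uone_subproof.

Fact umul_subproof (u v : units) :
  (uval u * uval v) * ((units_val u).2 * (units_val v).2) == 1.
Proof. by rewrite mulrACA !units_mulP mulr1. Qed.
Definition umul (u v : units) : units :=
  @Units (uval u * uval v, (units_val u).2 * (units_val v).2)
    (umul_subproof u v).

Fact uinv_subproof (u : units) : (units_val u).2 * uval u == 1.
Proof. by rewrite mulrC units_mulP. Qed.
Definition uinv (u : units) : units :=
  @Units ((units_val u).2, uval u) (uinv_subproof u).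

Fact uopp_subproof (u : units) : (- uval u) * (- (units_val u).2) == 1.
Proof. by rewrite mulrNN units_mulP. Qed.
Definition uopp (u : units) : units :=
  @Units (- uval u, - (units_val u).2) (uopp_subproof u).

Fact umulA : associative umul.
Proof. by move=> u v w; apply: uval_inj; rewrite /uval /= mulrA. Qed.
Fact umul1 : left_id uone umul.
Proof. by move=> u; apply: uval_inj; rewrite /uval /= mul1r. Qed.
Fact umulr1 : right_id uone umul.
Proof. by move=> u; apply: uval_inj; rewrite /uval /= mulr1. Qed.
Fact umulC : commutative umul.
Proof. by move=> u v; apply: uval_inj; rewrite /uval /= mulrC. Qed.
Fact umulV : left_inverse uone uinv umul.
Proof. by move=> u; apply: uval_inj; rewrite /uval /= mulrC units_mulP. Qed.
Fact umulrV : right_inverse uone uinv umul.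
Proof. by move=> u; rewrite umulC umulV. Qed.

HB.instance Definition _ :=
  isGroup.Build units umulA umul1 umulr1 umulV umulrV.
HB.instance Definition _ := Group_isAbelian.Build units umulC.

End Units.

Section GeneratedSubgroup.
Variables (H : abelianGroupType) (I : Type) (f : I -> H).

Definition gen_pred : pred H := fun g =>
  `[< forall P : {pred H}, group_closed P -> (forall i, f i \in P) -> g \in P >].

Fact gen_pred_closed : group_closed gen_pred.
Proof.
split=> [|g h /asboolP gP /asboolP hP]; apply/asboolP => P cP fP.
  by case: cP.
by case: (cP) => _; apply; [apply: gP cP fP | apply: hP cP fP].
Qed.

Record gen_group := GenGroup { gen_val : H; _ : gen_pred gen_val }.
HB.instance Definition _ := [isSub for gen_val].
HB.instance Definition _ := [Choice of gen_group by <:].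
HB.instance Definition _ :=
  SubChoice_isSubGroup.Build H gen_pred gen_group gen_pred_closed.

Fact gen_mulC : commutative (@monoid.mul gen_group).
Proof. by move=> u v; apply: val_inj; rewrite !valM abmulgC. Qed.
HB.instance Definition _ := Group_isAbelian.Build gen_group gen_mulC.

Fact gen_elt_subproof i : gen_pred (f i).
Proof. by apply/asboolP => P _; apply. Qed.
Definition gen_elt i : gen_group := GenGroup (gen_elt_subproof i).

End GeneratedSubgroup.

(* Finitely supported functions K -> int under convolution.  The product of
   {malg int[K]} itself is only provided for monoids without units. *)
Section GroupRing.
Local Open Scope fset_scope.
Variable K : abelianGroupType.

Definition group_ring := {malg int[K]}.
HB.instance Definition _ := GRing.Zmodule.on group_ring.

Implicit Types g : group_ring.

Definition grmul g1 g2 : group_ring :=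
  \sum_(k1 <- msupp g1) \sum_(k2 <- msupp g2)
    << g1@_k1 * g2@_k2 *g (k1 * k2)%g >>.

Definition grone : group_ring := << 1 *g 1%g >>.

Fact grmulw (d1 d2 : {fset K}) g1 g2 :
  msupp g1 `<=` d1 -> msupp g2 `<=` d2 ->
  grmul g1 g2 = \sum_(k1 <- d1) \sum_(k2 <- d2)
    << g1@_k1 * g2@_k2 *g (k1 * k2)%g >>.
Proof.
move=> le_d1 le_d2; rewrite /grmul (big_fset_incl _ le_d1) /=.
  apply/eq_bigr=> k1 _; apply/big_fset_incl => // k _ /mcoeff_outdom ->.
  by rewrite mulr0 monalgU0.
move=> k _ /mcoeff_outdom g1k.
by rewrite big1 => // k' _; rewrite g1k mul0r monalgU0.
Qed.

Fact grmulC : commutative grmul.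
Proof.
move=> g1 g2; rewrite /grmul exchange_big /=.
by apply: eq_bigr => k _; apply: eq_bigr => l _; rewrite mulrC abmulgC.
Qed.

Fact grmulDl : left_distributive grmul +%R.
Proof.
move=> g1 g2 g; pose d := msupp g1 `|` msupp g2.
rewrite (@grmulw d (msupp g) (g1 + g2)%R) ?msuppD_le //.
rewrite (@grmulw d (msupp g) g1) ?fsubsetUl //.
rewrite (@grmulw d (msupp g) g2) ?fsubsetUr //.
rewrite -big_split /=; apply: eq_bigr => k _.
rewrite -big_split /=; apply: eq_bigr => l _.
by rewrite mcoeffD mulrDl monalgUD.
Qed.

Fact grmul0 g : grmul 0 g = 0.
Proof. by rewrite /grmul msupp0 big_seq_fset0. Qed.

Fact grmulUU c1 c2 (k1 k2 : K) :
  grmul << c1 *g k1 >> << c2 *g k2 >> = << c1 * c2 *g (k1 * k2)%g >>.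
Proof. by rewrite (grmulw msuppU_le msuppU_le) !big_seq_fset1 !mcoeffUU. Qed.

Fact grmul_suml (I : Type) (r : seq I) (F : I -> group_ring) g :
  grmul (\sum_(i <- r) F i) g = \sum_(i <- r) grmul (F i) g.
Proof. exact: (big_morph (grmul^~ g) (fun _ _ => grmulDl _ _ _) (grmul0 g)). Qed.

Fact grmul_sumr (I : Type) (r : seq I) (F : I -> group_ring) g :
  grmul g (\sum_(i <- r) F i) = \sum_(i <- r) grmul g (F i).
Proof. by rewrite grmulC grmul_suml; apply: eq_bigr => i _; rewrite grmulC. Qed.

Fact grmulA : associative grmul.
Proof.
move=> g1 g2 g3; rewrite [g1]monalgE [g2]monalgE [g3]monalgE.
rewrite !(grmul_suml (msupp g1)); apply: eq_bigr => k1 _.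
rewrite !(grmul_suml (msupp g2)) !(grmul_sumr (msupp g2)).
rewrite (grmul_suml (msupp g2)); apply: eq_bigr => k2 _.
rewrite !(grmul_sumr (msupp g3)); apply: eq_bigr => k3 _.
by rewrite !grmulUU mulrA mulgA.
Qed.

Fact grmul1 : left_id grone grmul.
Proof.
move=> g; rewrite [g in LHS]monalgE grmul_sumr [RHS]monalgE.
by apply: eq_bigr => k _; rewrite grmulUU mul1r mul1g.
Qed.

Fact grone_neq0 : grone != 0.
Proof. by rewrite monalgU_eq0. Qed.

HB.instance Definition _ := GRing.Zmodule_isComNzRing.Build group_ring
  grmulA grmulC grmul1 grmulDl grone_neq0.

End GroupRing.

(* A graded abelian group, the direct sum of the M h, is given by its family of
   homogeneous parts; a graded isomorphism is an isomorphism in each degree. *)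
Definition graded (H : Type) := H -> zmodType.

Definition graded_iso (H : Type) (M N : graded H) : Prop :=
  forall h, exists phi : {additive M h -> N h}, bijective phi.

Section DependentFunctions.
Variables (I : Type) (V : I -> zmodType).

Definition dfun := forall i, V i.
HB.instance Definition _ := gen_eqMixin dfun.
HB.instance Definition _ := gen_choiceMixin dfun.

Implicit Types f g : dfun.
Definition dfun_zero : dfun := fun=> 0.
Definition dfun_opp f : dfun := fun i => - f i.
Definition dfun_add f g : dfun := fun i => f i + g i.

Fact dfun_addA : associative dfun_add.
Proof. by move=> f g h; apply: functional_extensionality_dep => i; apply: addrA. Qed.
Fact dfun_addC : commutative dfun_add.
Proof. by move=> f g; apply: functional_extensionality_dep => i; apply: addrC. Qed.
Fact dfun_add0 : left_id dfun_zero dfun_add.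
Proof. by move=> f; apply: functional_extensionality_dep => i; apply: add0r. Qed.
Fact dfun_addN : left_inverse dfun_zero dfun_opp dfun_add.
Proof. by move=> f; apply: functional_extensionality_dep => i; apply: addNr. Qed.

HB.instance Definition _ :=
  GRing.isZmodule.Build dfun dfun_addA dfun_addC dfun_add0 dfun_addN.

End DependentFunctions.

Section DirectSum.
Variables (I : eqType) (V : I -> zmodType).

Definition finite_support : pred (dfun V) := fun f =>
  `[< exists s : seq I, forall i, f i != 0 -> i \in s >].

Fact finite_support_closed : zmod_closed finite_support.
Proof.
split=> [|f g /asboolP[s fs] /asboolP[t gt]]; apply/asboolP.
  by exists [::] => i; rewrite eqxx.
exists (s ++ t) => i; rewrite mem_cat; apply: contraR; rewrite negb_or.
case/andP=> /(contraNeq (fs i)) fi0 /(contraNeq (gt i)) gi0.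
have -> : (f - g) i = f i - g i by [].
by rewrite fi0 gi0 subr0.
Qed.
HB.instance Definition _ :=
  GRing.isZmodClosed.Build (dfun V) finite_support finite_support_closed.

Record direct_sum := DirectSum { ds_val : dfun V; _ : finite_support ds_val }.
HB.instance Definition _ := [isSub for ds_val].
HB.instance Definition _ := [Choice of direct_sum by <:].
HB.instance Definition _ := [SubChoice_isSubZmodule of direct_sum by <:].

End DirectSum.

Section Subgroup.
Variables (V : zmodType) (P : zmodClosed V).
Record subgrp := SubGrp { subgrp_val : V; _ : subgrp_val \in P }.
HB.instance Definition _ := [isSub for subgrp_val].
HB.instance Definition _ := [Choice of subgrp by <:].
HB.instance Definition _ := [SubChoice_isSubZmodule of subgrp by <:].
End Subgroup.

Definition int_indep (V : zmodType) (n : nat) (e : 'I_n -> V) : Prop :=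
  forall c : 'I_n -> int, \sum_(i < n) e i *~ c i = 0 -> forall i, c i = 0.

Definition has_rank (V : zmodType) (n : nat) : Prop :=
  (exists e : 'I_n -> V, int_indep e) /\
  ~ (exists e : 'I_n.+1 -> V, int_indep e).

(* Junk value 0 when the rank is infinite. *)
Definition rankZ (V : zmodType) : nat :=
  if pselect (exists n, has_rank V n) is left ex then projT1 (cid ex) else 0%N.

(* Formal sums of group elements are given by their coefficients; infinite
   sums are allowed. *)
Definition formal_sum (H : Type) := H -> nat.

Definition gdim (H : Type) (M : graded H) : formal_sum H := fun h => rankZ (M h).

Section Shift.
Variable H : groupType.

Definition scale_sum (c : H) (F : formal_sum H) : formal_sum H :=
  fun h => F (c^-1 * h)%g.

Definition shift (M : graded H) (h : H) : graded H := fun r => M (h^-1 * r)%g.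

Definition shift_sum (M : graded H) (F : formal_sum H) : graded H := fun r =>
  direct_sum (fun hj : {h : H & 'I_(F h)} => shift M (tag hj) r).

End Shift.

Definition regrade (H K : eqType) (phi : H -> K) (M : graded H) : graded K :=
  fun r => direct_sum (fun k : {k : H | phi k == r} => M (val k)).

(* For a complex of graded modules with total module V and P = V^i_r,
   Q = V^(i-1)_r, this is the degree-r part of the i-th cohomology module.
   Coboundaries are taken inside the cocycles, so that the definition does not
   depend on a proof of d \o d = 0. *)
Section Cohomology.
Variables (V : zmodType) (d : {additive V -> V}) (P Q : zmodClosed V).

Definition cocycles : pred V := fun x => (x \in P) && (d x == 0).
Fact cocycles_closed : zmod_closed cocycles.
Proof.
split=> [|x y /andP[Px /eqP dx] /andP[Py /eqP dy]]; apply/andP; split.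
- exact: rpred0.
- by rewrite raddf0.
- exact: rpredB.
- by rewrite raddfB dx dy subrr.
Qed.
HB.instance Definition _ := GRing.isZmodClosed.Build V cocycles cocycles_closed.

Definition cocycle_group := subgrp (GRing.ZmodClosed.clone V cocycles _).

Definition coboundaries : pred cocycle_group := fun x =>
  `[< exists2 y, y \in Q & d y = val x >].
Fact coboundaries_closed : zmod_closed coboundaries.
Proof.
split=> [|x y /asboolP[x' Qx dx] /asboolP[y' Qy dy]]; apply/asboolP.
  by exists 0; rewrite ?rpred0 ?raddf0.
by exists (x' - y'); rewrite ?rpredB // !raddfB /= dx dy.
Qed.
HB.instance Definition _ :=
  GRing.isZmodClosed.Build cocycle_group coboundaries coboundaries_closed.

Definition cohomology : zmodType := 
  Quotient.quot (GRing.ZmodClosed.clone cocycle_group coboundaries _).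

End Cohomology.

Declare Scope biquandle_scope.
Reserved Notation "x |>_ y" (at level 45, left associativity).
Reserved Notation "x |>^ y" (at level 45, left associativity).

Record biquandle := Biquandle {
  bq_sort :> Type;
  bq_under : bq_sort -> bq_sort -> bq_sort
    where "x |>_ y" := (bq_under x y);
  bq_over : bq_sort -> bq_sort -> bq_sort
    where "x |>^ y" := (bq_over x y);
  bq_diag : forall x, x |>_ x = x |>^ x;
  bq_over_bij : forall y, bijective (fun x => x |>^ y);
  bq_under_bij : forall y, bijective (fun x => x |>_ y);
  bq_switch_bij :
    bijective (fun p : bq_sort * bq_sort => (p.2 |>^ p.1, p.1 |>_ p.2));
  bq_exchange1 : forall x y z,
    (x |>_ y) |>_ (z |>_ y) = (x |>_ z) |>_ (y |>^ z);
  bq_exchange2 : forall x y z,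
    (x |>_ y) |>^ (z |>_ y) = (x |>^ z) |>_ (y |>^ z);
  bq_exchange3 : forall x y z,
    (x |>^ y) |>^ (z |>^ y) = (x |>^ z) |>^ (y |>_ z)
}.

Notation "x |>_ y" := (bq_under x y) : biquandle_scope.
Notation "x |>^ y" := (bq_over x y) : biquandle_scope.
Local Open Scope biquandle_scope.

Section BracketAxioms.
Variables (X : biquandle) (R : comPzRingType).
Variables (A B : X -> X -> R) (delta : R).

Definition bracket_AAA := forall x y z,
  A x y * A y z * A (x |>_ y) (z |>^ y)
  = A x z * A (y |>^ x) (z |>^ x) * A (x |>_ z) (y |>_ z).

Definition bracket_ABB := forall x y z,
  A x y * B y z * B (x |>_ y) (z |>^ y)
  = B x z * B (y |>^ x) (z |>^ x) * A (x |>_ z) (y |>_ z).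

Definition bracket_BAB := forall x y z,
  B x y * A y z * B (x |>_ y) (z |>^ y)
  = B x z * A (y |>^ x) (z |>^ x) * B (x |>_ z) (y |>_ z).

Definition bracket_AAB := forall x y z,
  A x y * A y z * B (x |>_ y) (z |>^ y)
  = A x z * B (y |>^ x) (z |>^ x) * A (x |>_ z) (y |>_ z)
  + A x z * A (y |>^ x) (z |>^ x) * B (x |>_ z) (y |>_ z)
  + delta * A x z * B (y |>^ x) (z |>^ x) * B (x |>_ z) (y |>_ z)
  + B x z * B (y |>^ x) (z |>^ x) * B (x |>_ z) (y |>_ z).

Definition bracket_BAA := forall x y z,
  B x z * A (y |>^ x) (z |>^ x) * A (x |>_ z) (y |>_ z)
  = B x y * A y z * A (x |>_ y) (z |>^ y)
  + A x y * B y z * A (x |>_ y) (z |>^ y)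
  + delta * B x y * B y z * A (x |>_ y) (z |>^ y)
  + B x y * B y z * B (x |>_ y) (z |>^ y).

End BracketAxioms.

Record bracket (X : biquandle) (R : comPzRingType) := Bracket {
  brA : X -> X -> units R;
  brB : X -> X -> units R;
  br_delta : R;
  br_w : units R;
  br_wE : forall x,
    uval br_w = - (uval (brA x x) ^+ 2 * uval (brB x x)^-1%g);
  br_deltaE : forall x y,
    br_delta = - (uval (brA x y) * uval (brB x y)^-1%g)
               - uval (brA x y)^-1%g * uval (brB x y);
  br_AAA : bracket_AAA (fun x y => uval (brA x y));
  br_ABB :
    bracket_ABB (fun x y => uval (brA x y)) (fun x y => uval (brB x y));
  br_BAB :
    bracket_BAB (fun x y => uval (brA x y)) (fun x y => uval (brB x y));
  br_AAB : bracket_AAB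
    (fun x y => uval (brA x y)) (fun x y => uval (brB x y)) br_delta;
  br_BAA : bracket_BAA
    (fun x y => uval (brA x y)) (fun x y => uval (brB x y)) br_delta
}.

(* Crossings are drawn with both strands pointing downwards.  A corner of a
   crossing is (bottom?, right?): a strand enters at a top corner and leaves at
   the opposite bottom corner.  The permutation [next] sends the (crossing,
   right?) of a bottom corner to the (crossing, right?) of the top corner at
   which the semiarc leaving there arrives. *)
Section PlanarMap.
Variables (n : nat) (next : {perm 'I_n * bool}).

Definition dart := ('I_n * (bool * bool))%type.

Definition turn (d : dart) : dart :=
  let: (tau, (b, r)) := d in (tau, (~~ r, b)).

Definition opposite (d : dart) : dart :=
  let: (tau, (b, r)) := d in
  let: (sigma, r') := if b then next (tau, r) else (next^-1)%g (tau, r) in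
  (sigma, (~~ b, r')).

Definition face (d : dart) : dart := turn (opposite d).

Definition adjacent : rel dart :=
  fun d d' => (d' == turn d) || (d' == opposite d).

(* Euler's formula V - E + F = 2C for the 4-valent map with V = n crossings
   and E = 2n edges: each of its C components has genus 0. *)
Definition planar : Prop :=
  (n + fcard face {: dart} = 2 * n + 2 * n_comp adjacent {: dart})%N.

End PlanarMap.

Record diagram := Diagram {
  crossings : nat;
  loops : nat;  (* closed components without crossings *)
  next : {perm 'I_crossings * bool};
  positive : pred 'I_crossings;
  diagram_planar : planar next
}.

Section Diagram.
Variable D : diagram.

Notation crossing := 'I_(crossings D).

Definition n_plus : nat := #|[pred tau : crossing | positive tau]|.
Definition n_minus : nat := #|[pred tau : crossing | ~~ positive tau]|.

(* A semiarc is named by the bottom corner that it leaves; a component without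
   crossings is a single semiarc. *)
Definition semiarc := ((crossing * bool) + 'I_(loops D))%type.

Definition bottom_left (tau : crossing) : semiarc := inl (tau, false).
Definition bottom_right (tau : crossing) : semiarc := inl (tau, true).
Definition top_left (tau : crossing) : semiarc :=
  inl (((next D)^-1)%g (tau, false)).
Definition top_right (tau : crossing) : semiarc :=
  inl (((next D)^-1)%g (tau, true)).

(* The under-strand goes from top left to bottom right at a positive crossing,
   from top right to bottom left at a negative one. *)
Definition left_under (tau : crossing) : semiarc :=
  if positive tau then top_left tau else bottom_left tau.
Definition right_under (tau : crossing) : semiarc :=
  if positive tau then bottom_right tau else top_right tau.
Definition left_over (tau : crossing) : semiarc :=
  if positive tau then bottom_left tau else top_left tau.
Definition right_over (tau : crossing) : semiarc :=
  if positive tau then top_right tau else bottom_right tau.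

Definition vertex := {ffun crossing -> bool}.

Definition ones (v : vertex) : nat := #|[pred tau | v tau]|.

(* The 0-smoothing is vertical at a positive crossing and horizontal at a
   negative one. *)
Definition vertical (v : vertex) (tau : crossing) : bool :=
  if positive tau then ~~ v tau else v tau.

Definition joined (v : vertex) : rel semiarc := fun e e' =>
  [exists tau,
    let arcs := if vertical v tau
      then [:: (top_left tau, bottom_left tau);
               (top_right tau, bottom_right tau)]
      else [:: (top_left tau, top_right tau);
               (bottom_left tau, bottom_right tau)] in
    ((e, e') \in arcs) || ((e', e) \in arcs)].

(* A circle of the smoothing is identified with its set of semiarcs. *)
Definition semiarcs_through (v : vertex) (e : semiarc) : {set semiarc} :=
  [set e' | connect (joined v) e e'].

Definition circle (v : vertex) :=
  {c : {set semiarc} | c \in [set semiarcs_through v e | e : semiarc]}.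

Fact circle_of_subproof v e :
  semiarcs_through v e \in [set semiarcs_through v e | e : semiarc].
Proof. exact: imset_f. Qed.
Definition circle_of v e : circle v :=
  exist _ (semiarcs_through v e) (circle_of_subproof v e).

(* A label is the exponent of t in the S-basis 1 = t^0, t = t^1 of
   M = S[t]/(t^2).  The tensor product over S of one copy of M for each circle
   is free on the pure tensors of basis vectors, which are the labellings. *)
Definition labelling (v : vertex) := {ffun circle v -> bool}.

(* The coefficient of t^c in m(t^a (x) t^b), where m sends 1 (x) 1 to 1,
   1 (x) t and t (x) 1 to t, and t (x) t to 0. *)
Definition mult_coef (a b c : bool) : bool := (a + b == c)%N.

(* The coefficient of t^b (x) t^c in Delta(t^a), where Delta sends 1 to
   1 (x) t + t (x) 1, and t to t (x) t. *)
Definition comult_coef (a b c : bool) : bool := (b + c == a.+1)%N.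

Definition is_edge (v : vertex) (tau : crossing) (v' : vertex) : bool :=
  ~~ v tau && (v' == [ffun sigma => (sigma == tau) || v sigma]).

(* Coefficient of the basis vector b in the image of the basis vector a under m
   or Delta, when v' is obtained from v by changing the smoothing of tau.  In
   either smoothing, the semiarcs at the top left and at the bottom right of
   tau lie on different arcs, so the circles through them are the ones that
   are merged or obtained by splitting. *)
Definition edge_coef tau v v' (a : labelling v) (b : labelling v') : bool :=
  let c1 := circle_of v (top_left tau) in
  let c2 := circle_of v (bottom_right tau) in
  let c1' := circle_of v' (top_left tau) in
  let c2' := circle_of v' (bottom_right tau) in
  [forall e, (circle_of v e \notin [:: c1; c2]) ==>
             (a (circle_of v e) == b (circle_of v' e))]
  && (if c1 != c2 then mult_coef (a c1) (a c2) (b c1')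
      else comult_coef (a c1) (b c1') (b c2')).

Section Cube.
Variables (S : comNzRingType) (weight : crossing -> S).

Definition vertex_module (v : vertex) : lmodType S :=
  {ffun labelling v -> S^o}.

Definition edge_map tau v v' (x : vertex_module v) : vertex_module v' :=
  [ffun b => \sum_(a | edge_coef tau a b) x a].

(* The direct sum over all vertices, hence over all homological degrees; see
   [cube_part] for its homogeneous parts. *)
Definition cube := dfun vertex_module.

Definition cube_diff (x : cube) : cube := fun v' =>
  \sum_v \sum_(tau | is_edge v tau v')
    (-1) ^+ #|[pred sigma : crossing | (sigma < tau)%N && v sigma]|
    *: (weight tau *: edge_map tau v' (x v)).

Fact edge_map_additive tau v v' : zmod_morphism (@edge_map tau v v').
Proof.
move=> x y; apply/ffunP => b; rewrite !ffunE -sumrB.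
by apply: eq_bigr => a _; rewrite !ffunE.
Qed.

Fact cube_diff_additive : zmod_morphism cube_diff.
Proof.
move=> x y; apply: functional_extensionality_dep => v'.
have -> : (cube_diff x - cube_diff y) v' = cube_diff x v' - cube_diff y v' by [].
rewrite /cube_diff -sumrB; apply: eq_bigr => v _.
rewrite -sumrB; apply: eq_bigr => tau _.
by rewrite -!scalerBr -edge_map_additive.
Qed.
HB.instance Definition _ :=
  GRing.isZmodMorphism.Build cube cube cube_diff cube_diff_additive.

(* The shift by [-n_-] is included. *)
Definition homological_degree (v : vertex) : int :=
  (ones v)%:Z - n_minus%:Z.

(* Elements concentrated in homological degree i whose coefficient at each
   basis vector a lies in the prescribed subgroup P a of S. *)
Variable P : forall v, labelling v -> zmodClosed S.

Definition cube_part (i : int) : pred cube := fun x =>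
  [forall v, forall a,
    (x v a \in P a) && ((x v a != 0) ==> (homological_degree v == i))].

Fact cube_part_closed i : zmod_closed (cube_part i).
Proof.
split=> [|x y /forallP xP /forallP yP]; apply/forallP => v; apply/forallP => a.
  have -> : (0 : cube) v a = 0 by rewrite ffunE.
  by rewrite rpred0 eqxx.
have /andP[xa xi] := forallP (xP v) a; have /andP[ya yi] := forallP (yP v) a.
have -> : (x - y) v a = x v a - y v a by rewrite !ffunE.
rewrite rpredB //=; apply/implyP; apply: contraR => ni.
rewrite (negbTE ni) !implybF !negbK in xi yi.
by rewrite (eqP xi) (eqP yi) subrr.
Qed.
HB.instance Definition _ i :=
  GRing.isZmodClosed.Build cube (cube_part i) (cube_part_closed i).

Definition cube_cohomology (i : int) : zmodType :=
  cohomology cube_diff (GRing.ZmodClosed.clone cube (cube_part i) _)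
                       (GRing.ZmodClosed.clone cube (cube_part (i - 1)) _).

End Cube.

(* Z as a ring graded trivially by Z. *)
Definition int_part (k : int) : pred int := fun z => (z != 0) ==> (k == 0).
Fact int_part_closed k : zmod_closed (int_part k).
Proof.
split=> [|x y]; first by rewrite unfold_in /int_part eqxx.
rewrite !unfold_in /int_part; case: (k == 0); rewrite ?implybT // !implybF !negbK.
by move=> /eqP-> /eqP->; rewrite subrr.
Qed.
HB.instance Definition _ k :=
  GRing.isZmodClosed.Build int (int_part k) (int_part_closed k).

(* Degree of the basis vector a, the shift by n_+ - 2 n_- included. *)
Definition quantum_degree (v : vertex) (a : labelling v) : int :=
  \sum_(c : circle v) (if a c then -1 else 1)
  + (ones v)%:Z + n_plus%:Z - (2 * n_minus)%N%:Z.

Definition Kh (i : int) : graded int := fun k =>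
  cube_cohomology (S := int) (fun=> 1)
    (fun v (a : labelling v) =>
       GRing.ZmodClosed.clone int (int_part (k - quantum_degree a)) _)
    i.

End Diagram.

Record coloring (X : biquandle) (D : diagram) := Coloring {
  color :> semiarc D -> X;
  coloring_under : forall tau,
    color (right_under tau) = color (left_under tau) |>_ color (left_over tau);
  coloring_over : forall tau,
    color (right_over tau) = color (left_over tau) |>^ color (left_under tau)
}.

Section BracketHomology.
Variables (R : comPzRingType) (X : biquandle) (x0 : X) (beta : bracket X R).

Notation A := (brA beta).
Notation B := (brB beta).

Definition qxy (x y : X) : units R := uopp ((A x y)^-1 * B x y)%g.
Definition q0 : units R := qxy x0 x0.
Definition w0 : units R := uopp (A x0 x0 ^+ 2 * (B x0 x0)^-1)%g.

Definition grading_group : abelianGroupType :=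
  gen_group (fun xy : X * X => (q0 * (qxy xy.1 xy.2)^-1)%g).

Definition bracket_ring : comNzRingType := group_ring grading_group.

(* The homogeneous part of degree r of Z[G], where g in G has degree g. *)
Definition ring_part (r : units R) : pred bracket_ring := fun s =>
  all (fun g : grading_group => val g == r) (msupp s).

Fact ring_part_closed r : zmod_closed (ring_part r).
Proof.
split=> [|s t /allP sr /allP tr]; apply/allP => g; first by rewrite msupp0.
by move/(fsubsetP (msuppB_le s t)); rewrite inE => /orP[/sr|/tr].
Qed.
HB.instance Definition _ r :=
  GRing.isZmodClosed.Build bracket_ring (ring_part r) (ring_part_closed r).

Definition graded_ring : graded (units R) := fun r =>
  subgrp (GRing.ZmodClosed.clone bracket_ring (ring_part r) _).

Variables (D : diagram) (f : coloring X D).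

Notation x_ tau := (f (left_under tau)).
Notation y_ tau := (f (left_over tau)).

Definition coefficient (tau : 'I_(crossings D)) (smoothing : bool) : units R :=
  let a := A (x_ tau) (y_ tau) in
  let b := B (x_ tau) (y_ tau) in
  if positive tau then (if smoothing then b else a)
  else (if smoothing then a^-1 else b^-1)%g.

Definition vertex_shift (v : vertex D) : units R :=
  (uopp 1 ^+ ones v * \prod_tau coefficient tau (v tau))%g.

Definition total_shift : units R :=
  (uopp 1 ^+ n_minus D * expgz w0 ((n_minus D)%:Z - (n_plus D)%:Z))%g.

(* Degree of the basis vector a of the shifted complex; its multiple by s in S
   of degree g has degree g * bracket_degree a. *)
Definition bracket_degree (v : vertex D) (a : labelling v) : units R :=
  (total_shift * vertex_shift v * \prod_(c : circle v) (if a c then q0^-1 else q0))%g.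

Definition edge_weight (tau : 'I_(crossings D)) : bracket_ring :=
  << 1 *g gen_elt (fun xy : X * X => (q0 * (qxy xy.1 xy.2)^-1)%g)
            (x_ tau, y_ tau) >>.

Definition H_beta (i : int) : graded (units R) := fun r =>
  cube_cohomology edge_weight
    (fun v (a : labelling v) => GRing.ZmodClosed.clone bracket_ring
       (ring_part (r * (bracket_degree a)^-1)%g) _)
    i.

Definition Kh_beta (i : int) : graded (units R) := regrade (expgz q0) (Kh D i).

Definition Z_beta : formal_sum (units R) :=
  scale_sum
    ((\prod_(tau | positive tau) (A (x_ tau) (y_ tau) * (A x0 x0)^-1))
     * (\prod_(tau | ~~ positive tau) ((B (x_ tau) (y_ tau))^-1 * B x0 x0)))%g
    (gdim graded_ring).

End BracketHomology.

(* Main.v *)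
From HB Require Import structures.
From mathcomp Require Import all_boot all_algebra perm cyclic.
From mathcomp Require Import ring_quotient generic_quotient finmap boolp zify.
From mathcomp.multinomials Require Import monalg.
Require Import Defs.

(** Write q for q_(x0,x0), g_tau for q / q_(x_tau,y_tau) in G, and c for the
product of local factors in front of gdim S in Z_beta(f).

Rescaling.  At a vertex v put W_v, the product of the g_tau over the crossings
that v smooths by 1 ([path_weight]).  Every edge that changes the smoothing of
tau satisfies W_(v') = g_tau W_v, so x_v |-> W_v x_v carries the differential
with all weights 1 to the differential with weights g_tau.  Hence the complex over
S = Z[G] is a direct sum, over g in G, of copies of the integral Khovanov
complex; the copy of g is spanned at v by g W_v.  Moreover W_v has the degree
that aligns the gradings: by [bracket_degreeE], a basis vector of Khovanov
degree k at v has, once multiplied by W_v, the degree c q^k.  So the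
degree-r part of the complex is the sum of the degree-k parts of the copies of
g, over all pairs (g, k) with c g q^k = r, and each c g is the degree of exactly
one copy in the formal sum Z_beta(f) = c gdim S, because the part of Z[G] in
degree g has rank 1 ([rank_graded_ring1]).

Splitting.  The copies for different g split off without further thought, but q
may have finite order, so that many k occur with the same g; that the
cohomology splits along k needs the differential to preserve the quantum degree
([edge_degree]).  This amounts to the fact that changing one smoothing changes
the number of circles ([bifurcation]), which fails for virtual diagrams and is
where planarity enters.  Given a checkerboard colouring of the faces, orient
every semiarc so that the black face is on its left; at a crossing the four ends
then alternate between incoming and outgoing, all smoothings are compatible with
this orientation, and the circles are the cycles of a permutation of the
semiarcs.  Changing one smoothing multiplies it by a transposition, which merges
two cycles or splits one.

Checkerboard colouring.  It is extracted from Euler's formula V - E + F = 2 C by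
a covering argument ([bipartite_of_planar]).  Every 4-valent map on a closed
orientable surface has a double cover in which all vertices, edges and faces
lift to two copies and in which the ends alternate between the sheets.  The
inequality V - E + F <= 2 C, valid for all maps ([euler_le]), forces the cover of
a planar map to have twice as many components, that is, to be trivial; the sheet
is then the required alternating labelling. *)

Set Implicit Arguments.
Unset Strict Implicit.
Unset Printing Implicit Defensive.

Import GRing.Theory.

(** * The genus of a pair of permutations is nonnegative *)

Section Components.
Local Notation root := fingraph.root.
Variable T : finType.

Definition step2 (f g : T -> T) : rel T := fun x y => (y == f x) || (y == g x).

Lemma connect_mem_porbit (s : {perm T}) x y :
  fconnect s x y = (y \in porbit s x).
Proof.
apply/idP/porbitP => [|[k ->]]; last by rewrite permX fconnect_iter.
by move/iter_findex => <-; exists (findex s x y); rewrite permX.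
Qed.

Lemma card_porbits (s : {perm T}) : #|porbits s| = fcard s {: T}.
Proof.
have sy : connect_sym (frel s) by apply/fconnect_sym/perm_inj.
have -> : porbits s = porbit s @: [set x | roots (frel s) x].
  apply/setP => C; apply/imsetP/imsetP => -[x xT ->]; last by exists x.
  exists (root (frel s) x); first by rewrite inE roots_root.
  apply/eqP; rewrite eq_porbit_mem porbit_sym -connect_mem_porbit.
  exact: connect_root.
rewrite card_in_imset; last first.
  move=> x y; rewrite !inE => /eqP rx /eqP ry /eqP.
  rewrite eq_porbit_mem -connect_mem_porbit => /(fingraph.rootP sy).
  by rewrite [root _ x]rx [root _ y]ry.
rewrite cardsE; apply: eq_card => x; rewrite !inE /= andbT //.
Qed.

Lemma step2_sym (a b : T -> T) :
  injective a -> injective b -> connect_sym (step2 a b).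
Proof.
move=> ia ib x y.
suff H u v : connect (step2 a b) u v -> connect (step2 a b) v u.
  by apply/idP/idP; apply: H.
case/connectP=> p; elim: p u => [u _ -> //|w p IH u /= /andP[uw pw] lv].
apply: connect_trans (IH _ pw lv) _.
case/orP: uw => /eqP->.
  have: fconnect a (a u) u by rewrite fconnect_sym // fconnect1.
  by apply: connect_sub => s t /= /eqP <-; apply/connect1; rewrite /step2 eqxx.
have: fconnect b (b u) u by rewrite fconnect_sym // fconnect1.
by apply: connect_sub => s t /= /eqP <-; apply/connect1; rewrite /step2 eqxx orbT.
Qed.

(** Two components can only be fused into one by a single new link: sending
    the components of [e'] other than that of [y] to those of [e] is injective. *)
Lemma n_comp_link (e e' : rel T) x y :
    connect_sym e -> connect_sym e' -> subrel e' (connect e) ->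
    (forall u v, e u v -> connect e' u v \/ [/\ connect e' u x & connect e' y v] \/
         [/\ connect e' u y & connect e' x v]) ->
  n_comp e' {: T} <= (n_comp e {: T}).+1.
Proof.
move=> sy sy' ee' ee.
have {}ee u v : connect e u v -> connect e' u v
    \/ [/\ connect e' u x & connect e' y v] \/ [/\ connect e' u y & connect e' x v].
  case/connectP => p; elim/last_ind: p v => [v _ ->|p w IH v].
    by left; apply: connect0.
  rewrite rcons_path last_rcons => /andP[/IH{}IH pw ->].
  have:= IH _ erefl; have := ee _ _ pw; rewrite {IH pw}; move: (last u p) => t.
  case=> [tw|[[tx yw]|[ty xw]]].
  - case=> [ut|[[ux yt]|[uy xt]]].
    + by left; apply: connect_trans tw.
    + by right; left; split=> //; apply: connect_trans tw.
    + by right; right; split=> //; apply: connect_trans tw.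
  - case=> [ut|[[ux yt]|[uy xt]]].
    + by right; left; split=> //; apply: connect_trans tx.
    + by right; left.
    + by left; apply: connect_trans yw.
  - case=> [ut|[[ux yt]|[uy xt]]].
    + by right; right; split=> //; apply: connect_trans ty.
    + by left; apply: connect_trans xw.
    + by right; right.
have sub : subrel (connect e') (connect e) by apply: connect_sub.
rewrite /n_comp_mem.
rewrite (cardD1 (root e' y)); set D := predD1 _ _.
have -> /= : root e' y \in predI (roots e') {: T} by rewrite !inE roots_root.
rewrite add1n ltnS.
rewrite -(@card_in_image _ _ (root e) D); last first.
  move=> u v; rewrite !inE /= => /and3P[uy /eqP ru _] /and3P[vy /eqP rv _].
  move/(fingraph.rootP sy)/ee => -[/(fingraph.rootP sy')|]; first by rewrite ru rv.
  case=> [[_ /(fingraph.rootP sy')]|[/(fingraph.rootP sy') + _]].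
    by rewrite rv => E; rewrite E eqxx in vy.
  by rewrite ru => E; rewrite E eqxx in uy.
apply/subset_leq_card/subsetP => _ /imageP[u _ ->].
by rewrite !inE roots_root.
Qed.

(** With [a], [b] and [b * a] rotating around the vertices, edges and faces of
    a map on a closed orientable surface, this says that the genus is
    nonnegative.  Induction on [b], written as a product of transpositions:
    removing one raises the number of cycles of [b] by 1, changes that of
    [b * a] by 1, and if it disconnects a component then it also splits a cycle
    of [b * a], which pays for the new component. *)
Lemma euler_le (a b : {perm T}) :
  #|porbits a| + #|porbits b| + #|porbits (b * a)%g|
    <= #|T| + (n_comp (step2 a b) {: T}).*2.
Proof.
have [m] := ubnP (#|T| - #|porbits b|); elim: m b => // m IH b lem.
have id_or_moved (c : {perm T}) : c = 1%g \/ exists x, c x != x.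
  have [/forallP c1|/existsP[x cx]] := boolP [forall x, c x == x]; last first.
    by right; exists x.
  by left; apply/permP => x; rewrite perm1; apply/eqP/c1.
have [->|[x bx]] := id_or_moved b.
  have p1 : #|porbits (1 : {perm T})| <= #|T| by apply: leq_imset_card.
  have -> : n_comp (step2 a (1 : {perm T})%g) {: T} = #|porbits a|.
    rewrite card_porbits; apply: eq_n_comp => u v.
    apply/idP/idP; apply: connect_sub => s t; last first.
      by move=> /= /eqP <-; apply: connect1; rewrite /step2 eqxx.
    by case/orP => /eqP ->; rewrite ?perm1 ?connect0 // fconnect1.
  by rewrite mul1g -addnn addnAC addnC leq_add2r.
pose y := b x; pose t := tperm x y; pose b' := (t * b)%g.
have xy : x != y by rewrite eq_sym.
have bE : b = (t * b')%g by rewrite mulgA tperm2 mul1g.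
have cb : #|porbits b'| = #|porbits b|.+1.
  have := porbits_mul_tperm b x y; rewrite xy -/t -/b' /= -[y]/(b x).
  by rewrite porbit_sym (mem_porbit b 1) /= addn0 addn1.
have := IH b'; rewrite cb.
have cT : #|porbits b'| <= #|T| by apply: leq_imset_card.
rewrite cb in cT.
have /[swap]/[apply] : #|T| - #|porbits b|.+1 < m.
  by apply: leq_trans (_ : #|T| - #|porbits b| <= m); [rewrite subnSK // | rewrite -ltnS].
have baE : (b * a = t * (b' * a))%g by rewrite mulgA -bE.
have := porbits_mul_tperm (b' * a)%g x y; rewrite /= -/t -baE xy addn1.
have e'sym : connect_sym (step2 a b') by apply/step2_sym/perm_inj/perm_inj.
have esym : connect_sym (step2 a b) by apply/step2_sym/perm_inj/perm_inj.
have b'E z : b' z = b z \/ (z = x /\ b' z = b y) \/ (z = y /\ b' z = y).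
  rewrite permM; case: tpermP => [->|->|_ _]; [by right; left| |by left].
  by right; right.
have ea u : connect (step2 a b) u (a u) by apply: connect1; rewrite /step2 eqxx.
have eb u : connect (step2 a b) u (b u) by apply: connect1; rewrite /step2 eqxx orbT.
have e'a u : connect (step2 a b') u (a u) by apply: connect1; rewrite /step2 eqxx.
have e'b u : connect (step2 a b') u (b' u) by apply: connect1; rewrite /step2 eqxx orbT.
have sub : subrel (step2 a b') (connect (step2 a b)).
  move=> u v /orP[/eqP->//|/eqP->].
  case: (b'E u) => [->//|[[-> ->]|[-> ->]]]; last exact: connect0.
  by apply: connect_trans (eb x) _; apply: eb.
have bE' u : b u = b' u \/ (u = x /\ b u = b' y) \/ (u = y /\ b u = b' x).
  have -> : b u = b' (t u) by rewrite [in LHS]bE permM.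
  by case: tpermP => [->|->|_ _]; [right; left|right; right|left].
have [xyc|nxyc] := boolP (connect (step2 a b') x y).
  move=> le_c le_g.
  have -> : n_comp (step2 a b) {: T} = n_comp (step2 a b') {: T}.
    apply: eq_n_comp => u v; apply/idP/idP; apply: connect_sub; last exact: sub.
    move=> s w /orP[/eqP->//|/eqP->].
    case: (bE' s) => [->//|[[-> ->]|[-> ->]]].
      by apply: connect_trans xyc _; apply: e'b.
    by rewrite (same_connect e'sym (_ : connect _ y x)) // e'sym.
  apply: leq_trans le_g; rewrite addnS addSn -addnS leq_add2l.
  by rewrite -le_c leq_addr.
have -> : x \notin porbit (b' * a)%g y.
  apply: contra nxyc; rewrite porbit_sym -connect_mem_porbit.
  apply: connect_sub => u v /= /eqP <-; rewrite permM.
  by apply: connect_trans (e'b u) _; apply: e'a.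
have le_n : n_comp (step2 a b') {: T} <= (n_comp (step2 a b) {: T}).+1.
  apply: (@n_comp_link _ _ x y) => // u v /orP[/eqP->|/eqP->]; first by left.
  case: (bE' u) => [->|[[-> ->]|[-> ->]]]; first by left.
    by right; left; split.
  by right; right; split.
rewrite /= addn2 => -[<-] le_g.
have : #|T| + (n_comp (step2 a b') {: T}).*2 <= #|T| + (n_comp (step2 a b) {: T}).+1.*2.
  by rewrite leq_add2l leq_double.
move/(leq_trans le_g); rewrite doubleS !addnS !addSn !ltnS //.
Qed.

End Components.

(** * Planar maps are bipartite *)

Lemma card_le_porbits (T : finType) (s : {perm T}) m :
  (s ^+ m = 1)%g -> 0 < m -> #|T| <= #|porbits s| * m.
Proof.
move=> sm m_gt0; rewrite -cardsT.
have -> : [set: T] = cover (porbits s).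
  apply/setP => x; rewrite inE; apply/esym/bigcupP.
  by exists (porbit s x); [apply: imset_f | apply: porbit_id].
apply: leq_trans (leq_card_cover _) _.
rewrite -sum_nat_const; apply: leq_sum => _ /imsetP[x _ ->].
rewrite porbit.unlock; apply: leq_trans (leq_imset_card _ _) _.
by apply: dvdn_leq => //; rewrite order_dvdn sm.
Qed.

Section DoubleCover.
Local Notation root := fingraph.root.
Variable T : finType.

Fact double_cover_inj (flip : bool) (s : {perm T}) :
  injective (fun z : T * bool => (s z.1, flip (+) z.2)).
Proof. by move=> [x i] [y j] [/perm_inj -> /addbI ->]. Qed.

Definition double_cover flip s : {perm T * bool} := perm (@double_cover_inj flip s).

Lemma double_coverX flip s k x i :
  (double_cover flip s ^+ k)%g (x, i) = ((s ^+ k)%g x, (flip && odd k) (+) i).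
Proof.
elim: k => [|k IH]; first by rewrite !expg0 !perm1 andbF.
by rewrite !expgSr !permM {}IH permE /= addbA; case: flip; case: (odd k).
Qed.

(** Lift [a] and [b] to two sheets, exchanging the sheets.  The lifts still have
    orders dividing 4 and 2, so they have at least 2n and 4n cycles, and
    [b * a] fixes the sheets, so that its number of cycles doubles.  Then
    [euler_le] forces at least twice as many components as before.  Hence no
    element is connected to its copy on the other sheet, and the sheet reached
    from the root of each component is the labelling. *)
Lemma bipartite_of_planar (a b : {perm T}) n :
    (a ^+ 4 = 1)%g -> (b ^+ 2 = 1)%g -> #|T| = 4 * n ->
    #|porbits (b * a)%g| = n + (n_comp (step2 a b) {: T}).*2 ->
  exists eps : T -> bool,
    forall x, eps (a x) = ~~ eps x /\ eps (b x) = ~~ eps x.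
Proof.
move=> a4 b2 cT cF.
pose a' := double_cover true a; pose b' := double_cover true b.
pose e := step2 a b; pose e' := step2 a' b'.
have symE : connect_sym e by apply/step2_sym/perm_inj/perm_inj.
have symE' : connect_sym e' by apply/step2_sym/perm_inj/perm_inj.
have baE z : (b' * a')%g z = double_cover false (b * a) z.
  by rewrite !permM ![double_cover _ _ _]permE /= permM negbK.
have /permP {}baE := baE.
have cT' : #|{: T * bool}| = 8 * n by rewrite card_prod card_bool cT mulnC mulnA.
have ca : 2 * n <= #|porbits a'|.
  rewrite -(leq_pmul2r (isT : 0 < 4)) mulnAC -cT'; apply: card_le_porbits => //.
  by apply/permP => -[x i]; rewrite double_coverX a4 !perm1.
have cb : 4 * n <= #|porbits b'|.
  rewrite -(leq_pmul2r (isT : 0 < 2)) mulnAC -cT'; apply: card_le_porbits => //.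
  by apply/permP => -[x i]; rewrite double_coverX b2 !perm1.
have cf : (#|porbits (b * a)|).*2 <= #|porbits (b' * a')|.
  have porbE x i : porbit (b' * a') (x, i) = setX (porbit (b * a) x) [set i].
    rewrite baE; apply/setP => -[y j]; rewrite in_setX in_set1.
    apply/porbitP/andP => [[k]|[/porbitP[k ->] /eqP->]].
      by rewrite double_coverX => -[-> ->]; rewrite mem_porbit /= eqxx.
    by exists k; rewrite double_coverX //.
  have -> : (#|porbits (b * a)|).*2 = #|setX (porbits (b * a)) [set: bool]|.
    by rewrite cardsX cardsT card_bool muln2.
  pose F (u : {set T} * bool) := setX u.1 [set u.2].
  rewrite -(@card_in_imset _ _ F); last first.
    move=> [C i] [C' i'] /setXP[/= /imsetP[x _ ->] _] /setXP[/= _ _] /setP E.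
    have [] : x \in C' /\ i = i'.
      by have := E (x, i); rewrite !inE porbit_id /= eqxx => /esym/andP[-> /eqP].
    move=> _ ii; rewrite -ii; congr pair; apply/setP => y.
    by have := E (y, i); rewrite !inE -ii eqxx !andbT.
  apply/subset_leq_card/subsetP => _ /imsetP[[C i] /setXP[/= /imsetP[x _ ->] _] ->].
  by rewrite /F /= -porbE imset_f.
have C'ge : (n_comp e {: T}).*2 <= n_comp e' {: T * bool}.
  have := euler_le a' b'; rewrite cT' -/e'; move: cf cF.
  by move: (n_comp _ _) (n_comp _ _) #|porbits (b * a)| => *; lia.
(* Paths lift to the cover, and the exchange of the sheets preserves paths. *)
have lift x i y : connect e x y -> exists j, connect e' (x, i) (y, j).
  case/connectP=> p; elim/last_ind: p y => [y _ ->|p w IH y]; first by exists i.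
  rewrite rcons_path last_rcons => /andP[/IH{}IH pw ->].
  have [j cj] := IH _ erefl; exists (~~ j); apply: connect_trans cj _.
  by apply: connect1; case/orP: pw => /eqP ->; rewrite /e' /step2 !permE /= eqxx ?orbT.
have flip x i y j : connect e' (x, i) (y, j) -> connect e' (x, ~~ i) (y, ~~ j).
  case/connectP=> p; elim/last_ind: p y j => [y j _ [-> ->]|p w IH y j].
    exact: connect0.
  rewrite rcons_path last_rcons => /andP[/IH{}IH pw E].
  case: (last _ p) IH pw => u k /(_ _ _ erefl) ck; rewrite -{}E => uk.
  apply: connect_trans ck _; apply: connect1.
  by move: uk; rewrite /e' /step2 !permE /= !xpair_eqE; case: (k); case: (j).
have sep x : ~~ connect e' (x, false) (x, true).
  apply/negP => xx.
  pose D := setX [set r | roots e r] [set: bool].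
  have cD : #|D| = (n_comp e {: T}).*2.
    rewrite cardsX cardsT card_bool muln2 cardsE; congr _.*2.
    by apply: eq_card => z; rewrite !inE andbT.
  have : {in D &, injective (root e')}.
    apply/imset_injP; rewrite eqn_leq leq_imset_card cD /=.
    apply: leq_trans C'ge _.
    apply/subset_leq_card/subsetP => -[y j]; rewrite !inE andbT => /eqP ry.
    have [k yk] := lift y j _ (connect_root e y).
    apply/imsetP; exists (root e y, k); first by rewrite !inE roots_root.
    by rewrite -[LHS]ry; apply/fingraph.rootP.
  have [j xj] := lift x false _ (connect_root e x).
  move=> /(_ (root e x, j) (root e x, ~~ j)).
  rewrite !inE roots_root //= => /(_ isT isT) inj.
  have [] // : (root e x, j) = (root e x, ~~ j); last by case: (j).
  apply: inj; apply/fingraph.rootP => //.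
  apply: connect_trans (flip _ _ _ _ xj).
  by apply: connect_trans xx; rewrite symE'.
exists (fun x => connect e' (root e x, false) (x, true)) => x.
have [j xj] := lift x true _ (connect_root e x).
have rel_step (y : T) (xy : e x y) (xy' : e' (x, true) (y, false)) :
    connect e' (root e y, false) (y, true) = ~~ connect e' (root e x, false) (x, true).
  have <- : root e x = root e y by apply/fingraph.rootP => //; apply: connect1.
  move: xj; rewrite symE' => xj.
  have ty : connect e' (root e x, j) (y, false) by apply: connect_trans (connect1 xy').
  case: j xj ty => xj ty.
    have /= -> := flip _ _ _ _ ty; apply/esym/negP => xF.
    have /= := flip _ _ _ _ xj; rewrite symE' => xF'.
    by have := sep x; rewrite (connect_trans xF' xF).
  rewrite xj; apply/negP => yT.
  by have := sep y; rewrite symE' in ty; rewrite (connect_trans ty yT).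
by split; apply: rel_step; rewrite ?/e ?/e' /step2 ?permE /= eqxx ?orbT.
Qed.

End DoubleCover.

(** * Changing one smoothing merges or splits circles *)

Section Checkerboard.
Variables (n : nat) (next : {perm 'I_n * bool}).
Local Notation opposite := (opposite next).

Lemma turn4 (d : dart n) : turn (turn (turn (turn d))) = d.
Proof. by case: d => tau [[] []]. Qed.

Lemma oppositeK : involutive opposite.
Proof.
case=> tau [[] r] /=.
  by case E: (next (tau, r)) => [s r'] /=; rewrite -E permK.
by case E: ((next^-1)%g (tau, r)) => [s r'] /=; rewrite -E permKV.
Qed.

Lemma turn_inj : injective (@turn n).
Proof. exact: (can_inj (g := fun d => turn (turn (turn d))) turn4). Qed.

(** [eps d] tells whether the semiarc of [d] is directed into the crossing, in
    the orientation that keeps the black faces on the left. *)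
Lemma checkerboard : planar next ->
  exists eps : dart n -> bool,
    forall d, eps (turn d) = ~~ eps d /\ eps (opposite d) = ~~ eps d.
Proof.
pose a := perm turn_inj; pose b := perm (inv_inj oppositeK).
move=> pl; have [|||| eps epsP] := @bipartite_of_planar _ a b n.
- by apply/permP => d; rewrite !expgS expg0 mulg1 !permM !permE turn4.
- by apply/permP => d; rewrite !expgS expg0 mulg1 !permM !permE oppositeK.
- by rewrite !card_prod card_ord !card_bool mulnC.
- rewrite card_porbits.
  have -> : fcard (b * a)%g {: dart n} = fcard (face next) {: dart n}.
    by apply: eq_fcard => d; rewrite permM !permE.
  have -> : n_comp (step2 a b) {: dart n} = n_comp (adjacent next) {: dart n}.
    by apply: eq_n_comp; apply: eq_connect => d d'; rewrite /step2 !permE.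
  by move: pl; rewrite /planar; lia.
by exists eps => d; have := epsP d; rewrite !permE.
Qed.

End Checkerboard.

Section Circles.
Variable D : diagram.
Local Notation opposite := (opposite (next D)).
Local Notation dart := (dart (crossings D)).
Variable eps : dart -> bool.
Hypothesis eps_turn : forall d, eps (turn d) = ~~ eps d.
Hypothesis eps_opposite : forall d, eps (opposite d) = ~~ eps d.

Definition semiarc_at (d : dart) : semiarc D :=
  let: (tau, (b, r)) := d in
  if b then inl (tau, r) else inl ((next D)^-1%g (tau, r)).

(** The dart at which the semiarc arrives in the alternating orientation,
    which need not agree with the orientation of the link. *)
Definition head_dart (p : 'I_(crossings D) * bool) : dart :=
  let d := (p.1, (true, p.2)) in if eps d then d else opposite d.

Definition smooth (vert : pred 'I_(crossings D)) (d : dart) : dart :=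
  let: (tau, (b, r)) := d in if vert tau then (tau, (~~ b, r)) else (tau, (b, ~~ r)).

Lemma eps_side tau b r : eps (tau, (b, ~~ r)) = ~~ eps (tau, (b, r)).
Proof.
have := eps_turn (tau, (true, true)); have := eps_turn (tau, (true, false)).
have := eps_turn (tau, (false, true)); have := eps_turn (tau, (false, false)).
by case: b r => [] [] /= -> -> -> *; rewrite ?negbK.
Qed.

Lemma eps_level tau b r : eps (tau, (~~ b, r)) = ~~ eps (tau, (b, r)).
Proof.
have := eps_turn (tau, (true, true)); have := eps_turn (tau, (true, false)).
have := eps_turn (tau, (false, true)); have := eps_turn (tau, (false, false)).
by case: b r => [] [] /= -> -> -> *; rewrite ?negbK.
Qed.

Lemma eps_smooth v d : eps (smooth v d) = ~~ eps d.
Proof.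
by case: d => tau [b r] /=; case: (v tau); rewrite (eps_side, eps_level).
Qed.

Lemma smoothK v : involutive (smooth v).
Proof. by case=> tau [b r] /=; case E: (v tau); rewrite /= E negbK. Qed.

Lemma eps_head_dart p : eps (head_dart p).
Proof. by rewrite /head_dart; case: ifP => //; rewrite eps_opposite => ->. Qed.

Lemma semiarc_at_head_dart p : semiarc_at (head_dart p) = inl p.
Proof.
rewrite /head_dart; case: p => tau r /=; case: ifP => // _.
by case E: (next D (tau, r)) => [s r'] /=; rewrite -E permK.
Qed.

Lemma semiarc_at_inj d d' : semiarc_at d = semiarc_at d' -> eps d = eps d' -> d = d'.
Proof.
have H tau r tau' r' : inl (tau, r) = inl ((next D)^-1%g (tau', r')) :> semiarc D ->
    eps (tau, (true, r)) <> eps (tau', (false, r')).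
  have /= := eps_opposite (tau, (true, r)) => + [] E.
  by rewrite E permKV => ->; case: (eps _).
case: d d' => [tau [[] r]] [tau' [[] r']] /=.
- by case=> -> ->.
- by move=> /H.
- by move=> /esym /H + /esym.
- by case=> /perm_inj[-> ->].
Qed.

Lemma head_dartK d : eps d -> forall p, semiarc_at d = inl p -> head_dart p = d.
Proof.
by move=> dE p E; apply: semiarc_at_inj; rewrite ?semiarc_at_head_dart ?eps_head_dart.
Qed.

Definition follow (vert : pred 'I_(crossings D)) (e : semiarc D) : semiarc D :=
  match e with inl p => semiarc_at (smooth vert (head_dart p)) | inr l => inr l end.

Lemma follow_inj v : injective (follow v).
Proof.
have arcL d : exists p, semiarc_at d = inl p by case: d => [? [[] ?]]; eexists.
case=> [p|l] [p'|l'] /=.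
- move/semiarc_at_inj; rewrite !eps_smooth !eps_head_dart => /(_ erefl).
  by move/(can_inj (smoothK v)) => E; rewrite -!semiarc_at_head_dart E.
- by have [q ->] := arcL (smooth v (head_dart p)).
- by have [q ->] := arcL (smooth v (head_dart p')).
- by move=> ->.
Qed.

Definition circle_perm vert : {perm semiarc D} := perm (@follow_inj vert).

Lemma circle_perm_semiarc vert d :
  eps d -> circle_perm vert (semiarc_at d) = semiarc_at (smooth vert d).
Proof.
move=> dE; rewrite permE.
have [p pE] : exists p, semiarc_at d = inl p by case: d dE => [? [[] ?]]; eexists.
by rewrite pE /= (head_dartK dE).
Qed.

Lemma joined_circle_perm v :
  connect (joined v) =2 fconnect (circle_perm (vertical v)).
Proof.
set s := circle_perm _.
have jE e e' : joined v e e' <->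
    exists d, e = semiarc_at d /\ e' = semiarc_at (smooth (vertical v) d).
  split=> [/existsP[tau]|[[tau [b r]] /= [-> ->]]]; last first.
    apply/existsP; exists tau; case: (vertical v tau); case: b; case: r => /=;
      by rewrite !inE !xpair_eqE !eqxx ?orbT.
  case E: (vertical v tau); rewrite /= !inE => /orP[]/orP[]/eqP[-> ->].
  - by exists (tau, (false, false)); rewrite /= E.
  - by exists (tau, (false, true)); rewrite /= E.
  - by exists (tau, (true, false)); rewrite /= E.
  - by exists (tau, (true, true)); rewrite /= E.
  - by exists (tau, (false, false)); rewrite /= E.
  - by exists (tau, (true, false)); rewrite /= E.
  - by exists (tau, (false, true)); rewrite /= E.
  - by exists (tau, (true, true)); rewrite /= E.
move=> e e'; apply/idP/idP; apply: connect_sub => x y.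
  move/jE => [d [-> ->]]; case dE: (eps d); first by rewrite -circle_perm_semiarc // fconnect1.
  rewrite fconnect_sym; last exact: perm_inj.
  have -> : semiarc_at d = s (semiarc_at (smooth (vertical v) d)).
    by rewrite circle_perm_semiarc ?eps_smooth ?dE // smoothK.
  exact: fconnect1.
move=> /= /eqP <-; case: x => [p|l]; last by rewrite permE connect0.
apply/connect1/jE; exists (head_dart p); rewrite semiarc_at_head_dart; split=> //.
by rewrite -circle_perm_semiarc ?eps_head_dart // semiarc_at_head_dart.
Qed.

Lemma circle_of_porbit v e e' :
  (circle_of v e == circle_of v e') = (e \in porbit (circle_perm (vertical v)) e').
Proof.
rewrite -val_eqE /= -eq_porbit_mem /semiarcs_through; congr (_ == _);
  by apply/setP => x; rewrite inE joined_circle_perm connect_mem_porbit.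
Qed.

End Circles.

(** Both smoothings of [tau] pair the incoming ends at the top left and the
    bottom right with the two outgoing ends, in opposite ways.  So the circle
    permutations differ by the transposition of these two semiarcs, and
    composing with a transposition separates its two points exactly if they
    were on one cycle. *)
Lemma bifurcation (D : diagram) (v v' : vertex D) tau : is_edge v tau v' ->
  (circle_of v (top_left tau) != circle_of v (bottom_right tau))
  = (circle_of v' (top_left tau) == circle_of v' (bottom_right tau)).
Proof.
case/andP => vt /eqP v'E.
have vertE sigma : vertical v' sigma = (sigma == tau) (+) vertical v sigma.
  rewrite /vertical v'E ffunE; case: eqP => [->|//]; rewrite (negbTE vt).
  by case: (positive _).
have [eps0 eps0P] := checkerboard (diagram_planar D).
(* The labelling and its negation both alternate; take the one in which
   the top left corner of [tau] is incoming. *)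
pose eps d := eps0 d (+) eps0 (tau, (false, false)) (+) true.
have eT d : eps (turn d) = ~~ eps d by rewrite /eps (eps0P d).1 !addNb.
have eO d : eps (opposite (next D) d) = ~~ eps d by rewrite /eps (eps0P d).2 !addNb.
have etl : eps (tau, (false, false)) by rewrite /eps addbb.
have ebr : eps (tau, (true, true)).
  by have := eps_level eT tau false true; rewrite (eps_side eT tau false false) etl.
rewrite !(circle_of_porbit eT eO); set s := circle_perm _ _ _; set s' := circle_perm _ _ _.
have sE' : s' = (tperm (top_left tau) (bottom_right tau) * s)%g.
  apply/permP => -[p|l]; last first.
    by rewrite permM tpermD // !permE.
  have dE := eps_head_dart eO p; rewrite -(semiarc_at_head_dart eps p).
  move: (head_dart _ p) dE => d dE.
  rewrite permM circle_perm_semiarc //.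
  have arc_eq d' : eps d' -> semiarc_at d = semiarc_at d' -> d = d'.
    by move=> d'E /(semiarc_at_inj eO); apply; rewrite dE d'E.
  case: tpermP => [/(arc_eq (tau, (false, false)) etl) ->
                  |/(arc_eq (tau, (true, true)) ebr) -> |nTL nBR].
  - rewrite -[bottom_right tau]/(semiarc_at (tau, (true, true))) circle_perm_semiarc //=.
    by rewrite vertE eqxx /=; case: (vertical v tau).
  - rewrite -[top_left tau]/(semiarc_at (tau, (false, false))) circle_perm_semiarc //=.
    by rewrite vertE eqxx /=; case: (vertical v tau).
  rewrite circle_perm_semiarc //; case: d dE nTL nBR {arc_eq} => sigma [b r] dE nTL nBR.
  rewrite /smooth vertE; case: (sigma =P tau) => //= E; subst sigma.
  case: b r dE nTL nBR => [] [] dE nTL nBR //.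
  - by have := eps_side eT tau true true; rewrite dE ebr.
  - by have := eps_side eT tau false false; rewrite dE etl.
(* A single semiarc cannot be incoming at both of its ends. *)
have neq : top_left tau != bottom_right tau.
  apply/eqP => E; have := @semiarc_at_inj _ _ eO (tau, (false, false)) (tau, (true, true)) E.
  by rewrite etl ebr => /(_ erefl).
have := porbits_mul_tperm s (top_left tau) (bottom_right tau).
have := porbits_mul_tperm s' (top_left tau) (bottom_right tau).
rewrite /= {1}sE' mulgA tperm2 mul1g -sE' neq.
by case: (_ \in _); case: (_ \in _) => //=; lia.
Qed.

Local Open Scope ring_scope.

(** * The cube differential preserves the quantum degree *)

Section Degree.
Variable D : diagram.
Implicit Types v : vertex D.

Lemma joined_sym v : symmetric (joined v).
Proof. by move=> e e'; apply: eq_existsb => tau /=; rewrite orbC. Qed.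

Lemma circle_of_connect v e e' : (circle_of v e == circle_of v e') = connect (joined v) e e'.
Proof.
have sy : connect_sym (joined v) by apply: sym_connect_sym (joined_sym v).
apply/eqP/idP => [/(congr1 val)/= /setP/(_ e')|ee'].
  by rewrite !inE connect0.
by apply/val_inj/setP => x; rewrite !inE (same_connect sy ee').
Qed.

Lemma circle_rep v (c : circle v) : {e | c = circle_of v e}.
Proof.
have /imsetP ex := valP c.
have {}ex : exists e, c == circle_of v e.
  by have [e _ E] := ex; exists e; rewrite -val_eqE /= -E.
by exists (xchoose ex); apply/eqP/(xchooseP ex).
Qed.

Definition corner_circles v tau :=
  [:: circle_of v (top_left tau); circle_of v (bottom_right tau)].

Lemma far_joined v v' tau e x :
    (forall sigma, sigma != tau -> v sigma = v' sigma) ->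
    circle_of v e \notin corner_circles v tau ->
  (joined v e x -> joined v' e x) /\ (joined v' e x -> joined v e x).
Proof.
move=> vv' far.
have arc y z : (y, z) \in (if vertical v tau
      then [:: (top_left tau, bottom_left tau); (top_right tau, bottom_right tau)]
      else [:: (top_left tau, top_right tau); (bottom_left tau, bottom_right tau)]) ->
    circle_of v y = circle_of v z.
  move=> yz; apply/eqP; rewrite circle_of_connect.
  by apply/connect1/existsP; exists tau; apply/orP; left.
have nTL : e <> top_left tau by move=> E; rewrite E !inE eqxx in far.
have nBR : e <> bottom_right tau by move=> E; rewrite E !inE eqxx orbT in far.
have nBL : e <> bottom_left tau.
  move=> E; move: far arc; rewrite E !inE; case: (vertical v tau) => far arc.
    by rewrite -(arc (top_left tau) (bottom_left tau)) ?eqxx // !inE eqxx in far.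
  by rewrite (arc (bottom_left tau) (bottom_right tau)) ?eqxx ?orbT // !inE eqxx orbT in far.
have nTR : e <> top_right tau.
  move=> E; move: far arc; rewrite E !inE; case: (vertical v tau) => far arc.
    by rewrite (arc (top_right tau) (bottom_right tau)) ?eqxx ?orbT // !inE eqxx orbT in far.
  by rewrite -(arc (top_left tau) (top_right tau)) ?eqxx // !inE eqxx in far.
have key (w w' : vertex D) : (forall sigma, sigma != tau -> w sigma = w' sigma) ->
    joined w e x -> joined w' e x.
  move=> ww' /existsP[sigma jn]; apply/existsP; exists sigma.
  have [st|st] := eqVneq sigma tau; last first.
    have -> // : vertical w' sigma = vertical w sigma by rewrite /vertical ww'.
  move: jn; rewrite st; case: (vertical w tau); rewrite /= !inE => /orP[]/orP[]/eqP[] *;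
  by exfalso; auto.
by split; apply: key => // sigma /vv'.
Qed.

(** A circle that avoids the corners of [tau] does not meet the arcs that are
    exchanged. *)
Lemma far_circle v v' tau e :
    (forall sigma, sigma != tau -> v sigma = v' sigma) ->
    circle_of v e \notin corner_circles v tau ->
  semiarcs_through v' e = semiarcs_through v e
  /\ circle_of v' e \notin corner_circles v' tau.
Proof.
move=> vv' far.
have along x : connect (joined v) e x -> circle_of v x \notin corner_circles v tau.
  by rewrite -circle_of_connect => /eqP <-.
have E : semiarcs_through v' e = semiarcs_through v e.
  apply/setP => x; rewrite !inE; apply/idP/idP => /connectP[p].
    elim/last_ind: p x => [x _ ->|p w IH x]; first exact: connect0.
    rewrite rcons_path last_rcons => /andP[/IH{}IH pw ->].
    have cl := IH _ erefl; apply: (connect_trans cl); apply: connect1.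
    by apply: (proj2 (far_joined _ vv' (along _ cl))).
  elim/last_ind: p x => [x _ ->|p w IH x]; first exact: connect0.
  rewrite rcons_path last_rcons => /andP[pp pw ->].
  apply: connect_trans (IH _ pp erefl) (connect1 _).
  have cl : connect (joined v) e (last e p) by apply/connectP; exists p.
  by apply: (proj1 (far_joined _ vv' (along _ cl))).
split=> //; move: far; rewrite !inE !circle_of_connect.
by move/setP: E => E; have := E (top_left tau); have := E (bottom_right tau);
  rewrite !inE => -> ->.
Qed.

Definition label_degree (b : bool) : int := if b then -1 else 1.

Lemma sum_far v v' tau (a : labelling v) (b : labelling v') :
    (forall sigma, sigma != tau -> v sigma = v' sigma) ->
    (forall e, circle_of v e \notin corner_circles v tau ->
       a (circle_of v e) = b (circle_of v' e)) ->
  \sum_(c | c \notin corner_circles v tau) label_degree (a c)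
  = \sum_(c | c \notin corner_circles v' tau) label_degree (b c).
Proof.
move=> vv' ab; have v'v sigma : sigma != tau -> v' sigma = v sigma by move/vv'.
pose h (w w' : vertex D) (c : circle w) := circle_of w' (sval (circle_rep c)).
have hE (w w' : vertex D) e : (forall sigma, sigma != tau -> w sigma = w' sigma) ->
    circle_of w e \notin corner_circles w tau ->
    h w w' (circle_of w e) = circle_of w' e.
  move=> ww' far; rewrite /h; case: circle_rep => e' /= E; apply: val_inj => /=.
  have far' := far; rewrite E in far'.
  by rewrite (far_circle ww' far).1 (far_circle ww' far').1; move/(congr1 val): E.
rewrite (reindex_onto (h v' v) (h v v')) /=; last first.
  move=> c; have [e ->] := circle_rep c => far.
  by rewrite hE // hE //; have [] := far_circle vv' far.
apply: eq_big => c.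
  have [e ->] := circle_rep c.
  apply/andP/idP => [[far /eqP E]|far].
    rewrite -E; have [e' e'E] := circle_rep (h v' v (circle_of v' e)).
    by rewrite e'E in far *; rewrite hE //; have [] := far_circle vv' far.
  rewrite [h v' v _]hE //; have [_ far'] := far_circle v'v far.
  by rewrite hE.
have [e ->] := circle_rep c => /andP[far /eqP E].
have [e' e'E] := circle_rep (h v' v (circle_of v' e)).
by rewrite e'E in far E *; rewrite -E hE // ab.
Qed.

Lemma sum_corner v tau (a : labelling v) :
  \sum_(c | c \in corner_circles v tau) label_degree (a c)
  = label_degree (a (circle_of v (top_left tau)))
    + if circle_of v (top_left tau) == circle_of v (bottom_right tau) then 0
      else label_degree (a (circle_of v (bottom_right tau))).
Proof.
rewrite (bigD1 (circle_of v (top_left tau))) ?inE ?eqxx //=; congr (_ + _).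
case: eqP => [E|/eqP nE].
  by rewrite big1 // => c; rewrite !inE -E orbb => /andP[->].
rewrite (big_pred1 (circle_of v (bottom_right tau))) // => c /=.
rewrite !inE; case: (eqVneq c (circle_of v (top_left tau))) => [->|_] /=.
  by rewrite (negbTE nE).
by rewrite andbT.
Qed.

(** With 1 in degree 1 and t in degree -1, both m and Delta lower the degree by
    1, which the shift by the number of ones compensates. *)
Lemma edge_degree v v' tau (a : labelling v) (b : labelling v') :
  is_edge v tau v' -> edge_coef tau a b -> quantum_degree a = quantum_degree b.
Proof.
move=> vv' /andP[/forallP far near]; have bif := bifurcation vv'.
have /andP[vt /eqP v'E] := vv'.
have v'v sigma : sigma != tau -> v sigma = v' sigma by rewrite v'E ffunE; case: eqP.
have {far} E := sum_far v'v (fun e h => eqP (implyP (far e) h)).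
have oE : ones v' = (ones v).+1.
  rewrite /ones (cardD1 tau) inE v'E ffunE eqxx add1n; congr _.+1.
  by apply: eq_card => s; rewrite !inE ffunE; case: eqP => [->|//]; rewrite (negbTE vt).
rewrite /quantum_degree oE; congr (_ - _); congr (_ + _).
rewrite [in RHS]intS addrA; congr (_ + _).
rewrite (bigID (fun c => c \in corner_circles v tau)) /=.
rewrite [in RHS](bigID (fun c => c \in corner_circles v' tau)) /=.
have := sum_corner tau a; have := sum_corner tau b; rewrite /label_degree in E *.
move=> -> ->; rewrite E; move: near bif.
rewrite /mult_coef /comult_coef.
move=> /[swap] <-; rewrite [in RHS]addrAC => near; congr (_ + _).
move: near; case: eqP => _ /=.
  by case: (a _) (b _) (b _) => [] [] [].
by case: (a _) (a _) (b _) => [] [] [].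
Qed.

End Degree.

(** * Degrees in the bracket complex *)

HB.instance Definition _ (H : abelianGroupType) :=
  SemiGroup.isCommutativeLaw.Build H (@monoid.mul H) (@abmulgC H).

Section IntegerPowers.
Local Open Scope group_scope.
Variable H : abelianGroupType.
Implicit Types g h : H.

Lemma abmulgACA : interchange (@monoid.mul H) (@monoid.mul H).
Proof. exact: Monoid.mulmACA. Qed.

Lemma abmulgAC : right_commutative (@monoid.mul H).
Proof. exact: Monoid.mulmAC. Qed.

Lemma abmulgCA : left_commutative (@monoid.mul H).
Proof. exact: Monoid.mulmCA. Qed.

Lemma abinvM g h : (g * h)^-1 = g^-1 * h^-1.
Proof. by rewrite invgM abmulgC. Qed.

Lemma abexpMn g h n : (g * h) ^+ n = g ^+ n * h ^+ n.
Proof. by apply: expgMn; apply: abmulgC. Qed.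

(** Every integer is such a difference; this avoids case analysis on signs. *)
Lemma expgz_sub g (m n : nat) : expgz g (m%:Z - n%:Z)%R = g ^+ m * g ^- n.
Proof.
have [/subnK<-|/ltnW/subnK<-] := leqP n m.
  by rewrite PoszD addrK expgnDr mulgK.
have -> : (m%:Z - (n - m + m)%N%:Z = - (n - m)%N%:Z)%R by lia.
have -> : expgz g (- (n - m)%N%:Z)%R = g ^- (n - m).
  by case: (n - m)%N => [|k]; rewrite /= ?expg0 ?invg1.
by rewrite expgnDr invgM mulgA mulgV mul1g.
Qed.

Lemma expgzD g : {morph expgz g : k l / (k + l)%R >-> k * l}.
Proof.
have split (k : int) : exists m n : nat, k = (m%:Z - n%:Z)%R.
  by case: k => [m|n]; [exists m, 0%N | exists 0%N, n.+1]; lia.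
move=> k l; have [m [n ->]] := split k; have [m' [n' ->]] := split l.
have -> : (m%:Z - n%:Z + (m'%:Z - n'%:Z) = (m + m')%N%:Z - (n + n')%N%:Z)%R by lia.
by rewrite !expgz_sub !expgnDr abinvM abmulgACA.
Qed.

Lemma expgz_sum g (I : finType) (F : I -> int) :
  expgz g (\sum_i F i)%R = \prod_i expgz g (F i).
Proof. apply: (big_morph (expgz g) (@expgzD g)). exact: expg0. Qed.

End IntegerPowers.

Section Degrees.
Variables (R : comPzRingType) (X : biquandle) (x0 : X) (beta : bracket X R).
Local Notation A := (brA beta).
Local Notation B := (brB beta).
Local Notation q := (q0 x0 beta).
Local Notation w := (w0 x0 beta).

Local Open Scope group_scope.

(** A name for -1 under which rewriting by [uoppE] terminates. *)
Definition minus1 : units R := uopp 1.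

Lemma uoppE (u : units R) : uopp u = minus1 * u.
Proof. by apply: uval_inj; rewrite /uval /= mulN1r. Qed.

Lemma minus1K : minus1 * minus1 = 1.
Proof. by apply: uval_inj; rewrite /uval /= mulrNN mulr1. Qed.

Lemma minus1V : minus1^-1 = minus1.
Proof. by apply: mulg1_eq minus1K. Qed.

(** Because A_(x0,x0) / B_(x0,x0) = - q^-1. *)
Lemma w0E : w = A x0 x0 * q^-1.
Proof.
rewrite /w0 /q0 /qxy !uoppE !abinvM minus1V invgK expg2 -!mulgA.
by rewrite [LHS]abmulgCA.
Qed.

Lemma minus1_w0E : minus1 * w = B x0 x0 * q ^- 2.
Proof.
rewrite w0E expg2 abinvM !mulgA; congr (_ * _).
rewrite /q0 /qxy !uoppE !abinvM minus1V invgK.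
by rewrite [B _ _ * _]abmulgC -!mulgA mulVg mulg1.
Qed.

Variables (D : diagram) (f : coloring X D).
Local Notation x_ tau := (f (left_under tau)).
Local Notation y_ tau := (f (left_over tau)).
Local Notation G := (grading_group x0 beta).

Definition weight_group_elt (tau : 'I_(crossings D)) : G :=
  gen_elt (fun xy : X * X => q * (qxy beta xy.1 xy.2)^-1) (x_ tau, y_ tau).

Definition path_weight (v : vertex D) : G := \prod_(tau | v tau) weight_group_elt tau.

Definition zero_coefficient tau : units R :=
  if positive tau then A (x_ tau) (y_ tau) else (B (x_ tau) (y_ tau))^-1.

Definition Z_coefficient : units R :=
  (\prod_(tau | positive tau) (A (x_ tau) (y_ tau) * (A x0 x0)^-1))
  * (\prod_(tau : 'I_(crossings D) | ~~ positive tau)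
      ((B (x_ tau) (y_ tau))^-1 * B x0 x0)).

(** Passing from the 0-smoothing to the 1-smoothing multiplies the coefficient
    by - q_(x,y), whatever the sign of the crossing; g_tau replaces q_(x,y) by
    q, and the sign cancels. *)
Lemma vertex_shiftE v :
  vertex_shift beta f v * val (path_weight v)
  = (\prod_tau zero_coefficient tau) * q ^+ ones v.
Proof.
have exp_ones (g : units R) : g ^+ ones v = \prod_tau (if v tau then g else 1).
  by rewrite -big_mkcond /= -prodg_const; apply: eq_bigl => tau; rewrite inE.
have valW : val (path_weight v) = \prod_(tau | v tau) val (weight_group_elt tau).
  by apply: (big_morph (fun g : G => val g)); [apply: valM | apply: val1].
rewrite valW (big_mkcond v) /vertex_shift -/minus1 !exp_ones -!big_split /=.
apply: eq_bigr => tau _; rewrite /coefficient /zero_coefficient.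
case: (v tau); last by rewrite !mulg1 mul1g.
rewrite /qxy !uoppE !abinvM minus1V invgK.
rewrite -!mulgA [q * _]abmulgC; case: (positive tau); rewrite !mulgA; congr (_ * _).
  rewrite [minus1 * _]abmulgC -[_ * _ * minus1]mulgA minus1K mulg1 abmulgAC mulgV mul1g //.
rewrite [minus1 * _]abmulgC -[_ * _ * minus1]mulgA minus1K mulg1 mulVg mul1g //.
Qed.

(** The final shift replaces the local factors at each crossing by their
    quotients with the factors for x0, at the price of the power of q that is
    also the final shift of Khovanov's complex. *)
Lemma total_shiftE :
  total_shift x0 beta D * \prod_tau zero_coefficient tau
  = Z_coefficient * expgz q ((n_plus D)%:Z - (2 * n_minus D)%N%:Z)%R.
Proof.
rewrite /total_shift -/minus1 expgz_sub mulgA -abexpMn minus1_w0E w0E expgz_sub.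
rewrite (bigID (@positive D)) /= /Z_coefficient !big_split /=.
have -> : \prod_(tau : 'I_(crossings D) | positive tau) (A x0 x0)^-1
        = (A x0 x0)^-1 ^+ n_plus D.
  by rewrite -prodg_const; apply: eq_bigl => tau; rewrite inE.
have -> : \prod_(tau : 'I_(crossings D) | ~~ positive tau) B x0 x0 = B x0 x0 ^+ n_minus D.
  by rewrite -prodg_const; apply: eq_bigl => tau; rewrite inE.
have -> : \prod_(tau | positive tau) zero_coefficient tau
        = \prod_(tau | positive tau) A (x_ tau) (y_ tau).
  by apply: eq_bigr => tau p; rewrite /zero_coefficient p.
have -> : \prod_(tau | ~~ positive tau) zero_coefficient tau
        = \prod_(tau | ~~ positive tau) (B (x_ tau) (y_ tau))^-1.
  by apply: eq_bigr => tau p; rewrite /zero_coefficient (negbTE p).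
rewrite !abexpMn !abinvM !expVgn invgK.
have -> : (q^-1 * q^-1) ^+ n_minus D = q ^- (2 * n_minus D).
  by rewrite -expg2 -expgnA expVgn.
move: (\prod_(_ | _) _) (\prod_(_ | _) _) => a b.
move: (B x0 x0 ^+ _) (A x0 x0 ^- _) (q ^+ _) (q ^- _) => c d e g.
by rewrite (AC ((2*2)*2) (((5*3)*(6*1))*(4*2))).
Qed.

Lemma bracket_degreeE v (a : labelling v) :
  bracket_degree x0 beta f a * val (path_weight v)
  = Z_coefficient * expgz q (quantum_degree a).
Proof.
rewrite /bracket_degree /quantum_degree.
have -> : \prod_(c : circle v) (if a c then q^-1 else q)
        = expgz q (\sum_(c : circle v) (if a c then -1 else 1))%R.
  by rewrite expgz_sum; apply: eq_bigr => c _; case: (a c).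
rewrite -addrA expgzD [LHS]abmulgAC.
rewrite -(mulgA (total_shift x0 beta D) (vertex_shift beta f v)) vertex_shiftE.
rewrite mulgA total_shiftE -!(mulgA Z_coefficient); congr (_ * _).
by rewrite -mulgA [LHS]abmulgC [q ^+ _ * _]abmulgC [expgz q (_ + (ones v)%:Z)%R]expgzD.
Qed.

End Degrees.

(** * Cohomology of a direct sum of complexes *)

Lemma inj_surj_bijective (S T : Type) (f : S -> T) :
  injective f -> (forall y, exists x, f x = y) -> bijective f.
Proof.
by move=> injf /choice[g fK]; exists g => // x; apply: injf; rewrite fK.
Qed.

Lemma zmod_morphism_additive (U V : zmodType) (f : U -> V) :
  zmod_morphism f -> exists phi : {additive U -> V}, phi =1 f.
Proof.
move=> fB; pose m := GRing.isZmodMorphism.Build U V f fB.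
pose phi : {additive U -> V} := HB.pack f m.
by exists phi.
Qed.

Lemma finite_preimage (S T : eqType) (f : S -> T) (s : seq T) :
  injective f -> exists t : seq S, forall x, f x \in s -> x \in t.
Proof.
move=> injf; elim: s => [|y s [t IH]]; first by exists [::].
have [[x xy]|nx] := pselect (exists x, f x = y).
  exists (x :: t) => z; rewrite !inE => /orP[/eqP|/IH->]; last by rewrite orbT.
  by rewrite -xy => /injf ->; rewrite eqxx.
by exists t => z; rewrite inE => /orP[/eqP zy|/IH //]; case: nx; exists z.
Qed.

Section DirectSums.

Lemma direct_sumP (I : eqType) (V : I -> zmodType) (f : dfun V) (s : seq I) :
  (forall i, f i != 0 -> i \in s) -> exists x : direct_sum V, ds_val x = f.
Proof.
move=> fs; have fP : f \in finite_support (V := V) by apply/asboolP; exists s.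
by exists (DirectSum fP).
Qed.

Lemma direct_sum_support (I : eqType) (V : I -> zmodType) (x : direct_sum V) :
  exists s : seq I, forall i, ds_val x i != 0 -> i \in s.
Proof. exact/asboolP/(valP x). Qed.

Lemma direct_sum_curry (I : eqType) (K : I -> eqType)
    (V : forall i, K i -> zmodType) :
  exists phi : {additive direct_sum (fun p : {i & K i} => V (tag p) (tagged p))
                 -> direct_sum (fun i => direct_sum (V i))}, bijective phi.
Proof.
set U := direct_sum _; set W := direct_sum _.
have tag_inj i : injective (@Tagged I i K).
  by move=> k l /eqP; rewrite eq_Tagged => /eqP.
have exF (x : U) i : exists z : direct_sum (V i), ds_val z = fun k => ds_val x (Tagged K k).
  have [s xs] := direct_sum_support x; have [t st] := finite_preimage s (tag_inj i).
  by apply: (direct_sumP (s := t)) => k /xs; apply: st.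
have exphi (x : U) : exists y : W, forall i k, ds_val (ds_val y i) k = ds_val x (Tagged K k).
  pose F i := sval (cid (exF x i)); have FE i : ds_val (F i) = _ := svalP (cid (exF x i)).
  have [s xs] := direct_sum_support x.
  have [i|y yE] := @direct_sumP _ _ (F : dfun _) (map tag s); last first.
    by exists y => i k; rewrite yE FE.
  apply: contraNT => /mapP si; apply/eqP/val_inj; rewrite /= FE.
  apply: functional_extensionality_dep => k.
  by apply/eqP; apply: contraT => /xs xk; case: si; exists (Tagged K k).
have [phi phiE] := choice exphi.
have phiB : zmod_morphism phi.
  move=> x y; apply/val_inj/functional_extensionality_dep => i.
  apply/val_inj/functional_extensionality_dep => k.
  have E : ds_val (ds_val (phi (x - y)) i) k = ds_val x (Tagged K k) - ds_val y (Tagged K k).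
    exact: phiE.
  by rewrite [LHS]E -!phiE.
have [psi psiE] := zmod_morphism_additive phiB; exists psi.
apply: inj_surj_bijective => [x y|y].
  rewrite !psiE => xy; apply/val_inj/functional_extensionality_dep => -[i k].
  by rewrite -[LHS](phiE x) -[RHS](phiE y) xy.
have [s ys] := direct_sum_support y.
pose T i := sval (cid (direct_sum_support (ds_val y i))).
have TP i := svalP (cid (direct_sum_support (ds_val y i))).
have [[i k] yik|x xE] := @direct_sumP _ _
    ((fun p => ds_val (ds_val y (tag p)) (tagged p))
       : dfun (fun p : {i & K i} => V (tag p) (tagged p)))
    (flatten [seq [seq Tagged K k | k <- T i] | i <- s]).
  apply/flatten_mapP; exists i; last by apply/map_f/TP.
  by apply: ys; apply: contraNneq yik => /= ->.
exists x; rewrite psiE; apply/val_inj/functional_extensionality_dep => i.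
apply/val_inj/functional_extensionality_dep => k.
by rewrite [LHS]phiE xE.
Qed.

End DirectSums.

Section CohomologyClasses.
Local Open Scope quotient_scope.
Variables (V : zmodType) (d : {additive V -> V}) (P Q : zmodClosed V).
Local Notation Cob := (GRing.ZmodClosed.clone (cocycle_group d P) (coboundaries (P := P) Q) _).

Lemma cocycleP x : reflect (x \in P /\ d x = 0) (x \in cocycles d P).
Proof. by apply: (iffP andP) => -[Px /eqP]. Qed.

(** The class of a cocycle, extended by 0 to a total function on cochains, so
    that no proof of the cocycle condition has to be carried along. *)
Definition coh_class (x : V) : cohomology d P Q :=
  \pi_(Quotient.quot Cob) (insubd (0 : cocycle_group d P) x).

Lemma coh_class_surj (c : cohomology d P Q) : exists2 x, x \in cocycles d P & coh_class x = c.
Proof.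
exists (val (repr (c : Quotient.quot Cob))); first exact: valP.
by rewrite /coh_class valKd reprK.
Qed.

Lemma coh_classB : {in cocycles d P &, {morph coh_class : x y / x - y}}.
Proof.
move=> x y xP yP; rewrite /coh_class -raddfB; congr (\pi_(_) _).
apply: val_inj; rewrite raddfB /= !insubdK //; exact: rpredB.
Qed.

Lemma coh_class_eq0 x : x \in cocycles d P ->
  coh_class x = 0 <-> exists2 y, y \in Q & d y = x.
Proof.
move=> xP.
have E : (coh_class x == 0) = (insubd (0 : cocycle_group d P) x \in Cob).
  by rewrite -[X in X \in _]subr0 Quotient.idealrBE raddf0.
split=> [/eqP|ex]; first by rewrite E => /asboolP[y Qy dy]; exists y; rewrite // dy insubdK.
by apply/eqP; rewrite E; apply/asboolP; have [y Qy dy] := ex; exists y; rewrite // insubdK.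
Qed.

End CohomologyClasses.

(** The complex (V, d), with parts P and Q in two consecutive degrees, is
    decomposed by projections [pr j] to copies of the complex (W, dW) and
    inclusions [inc j] of the parts [PJ j] and [QJ j] of the j-th copy.  Joint
    injectivity of the projections on P stands for the decomposition
    x = \sum_j inc j (pr j x), see [pr_decomp]. *)
Section Decomposition.
Variables (V W : zmodType) (d : {additive V -> V}) (dW : {additive W -> W}).
Variables (P Q : zmodClosed V) (J : eqType) (PJ QJ : J -> zmodClosed W).
Variables (pr : J -> {additive V -> W}) (inc : J -> {additive W -> V}).
Hypothesis pr_P : forall j x, x \in P -> pr j x \in PJ j.
Hypothesis pr_Q : forall j x, x \in Q -> pr j x \in QJ j.
Hypothesis inc_P : forall j y, y \in PJ j -> inc j y \in P.
Hypothesis inc_Q : forall j y, y \in QJ j -> inc j y \in Q.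
Hypothesis pr_d : forall j x, pr j (d x) = dW (pr j x).
Hypothesis inc_d : forall j y, inc j (dW y) = d (inc j y).
Hypothesis pr_inc : forall j k y, y \in PJ j -> pr k (inc j y) = if k == j then y else 0.
Hypothesis pr_eq0 : forall x, x \in P -> (forall j, pr j x = 0) -> x = 0.
Hypothesis pr_finite : forall x, exists s : seq J, forall j, pr j x != 0 -> j \in s.

Lemma pr_sum (y : J -> W) (s : seq J) k : uniq s -> (forall j, y j \in PJ j) ->
  pr k (\sum_(j <- s) inc j (y j)) = if k \in s then y k else 0.
Proof.
move=> us yP; rewrite raddf_sum /=; case: ifPn => ks; last first.
  rewrite big1_seq // => j /andP[_ js]; rewrite pr_inc //.
  by case: eqP => // kj; rewrite kj js in ks.
rewrite (bigD1_seq k) //= pr_inc // eqxx big1 ?addr0 // => j jk.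
by rewrite pr_inc // eq_sym (negbTE jk).
Qed.

Lemma pr_decomp x : x \in P ->
  exists s : seq J, [/\ uniq s, forall j, pr j x != 0 -> j \in s
                      & x = \sum_(j <- s) inc j (pr j x)].
Proof.
move=> Px; have [s sP] := pr_finite x; exists (undup s).
have sP' j : pr j x != 0 -> j \in undup s by move/sP; rewrite mem_undup.
split; rewrite ?undup_uniq //; apply/eqP; rewrite -subr_eq0; apply/eqP/pr_eq0.
  by rewrite rpredB // rpred_sum // => j _; apply/inc_P/pr_P.
move=> j; rewrite raddfB /= (@pr_sum (fun j => pr j x)) ?undup_uniq //; last first.
  by move=> k; apply: pr_P.
case: ifPn; first by rewrite subrr.
by move/(contraNT (sP' j)) => /eqP ->; rewrite subr0.
Qed.

Lemma pr_cocycle j x : x \in cocycles d P -> pr j x \in cocycles dW (PJ j).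
Proof.
by case/cocycleP => Px dx; apply/cocycleP; rewrite -pr_d dx raddf0; split=> //; apply: pr_P.
Qed.

(** Classes are projected on representatives; primitives and representatives
    of the components are glued by the inclusions. *)
Lemma cohomology_direct_sum :
  exists phi : {additive cohomology d P Q
                 -> direct_sum (fun j => cohomology dW (PJ j) (QJ j))},
    bijective phi.
Proof.
pose C j := coh_class dW (PJ j) (QJ j).
have exphi (c : cohomology d P Q) :
    exists z : direct_sum (fun j => cohomology dW (PJ j) (QJ j)),
    forall x, x \in cocycles d P -> coh_class d P Q x = c ->
    forall j, ds_val z j = C j (pr j x).
  have [x xP <-] := coh_class_surj c; have [s sP] := pr_finite x.
  have [j|z zE] := @direct_sumP _ _ ((fun j => C j (pr j x)) : dfun _) s.
    move=> Cj; apply: sP; apply: contraNneq Cj => ->.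
    apply/eqP/coh_class_eq0; first exact: rpred0.
    by exists 0; rewrite ?rpred0 ?raddf0.
  exists z => x' x'P cx j; rewrite zE; apply/eqP; rewrite -subr_eq0 /C.
  rewrite -coh_classB ?pr_cocycle //; apply/eqP.
  have xB : x - x' \in cocycles d P by apply: rpredB.
  rewrite -raddfB; apply/coh_class_eq0; first exact: pr_cocycle.
  have /coh_class_eq0 - /(_ xB)[y Qy dy] : coh_class d P Q (x - x') = 0.
    by rewrite coh_classB // cx subrr.
  by exists (pr j y); rewrite ?pr_Q // -pr_d dy.
have [phi phiE] := choice exphi.
have phiB : zmod_morphism phi.
  move=> c c'; have [x xP xc] := coh_class_surj c; have [x' x'P xc'] := coh_class_surj c'.
  apply/val_inj/functional_extensionality_dep => j.
  have E : ds_val (phi (c - c')) j = C j (pr j (x - x')).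
    by apply: phiE; rewrite ?rpredB // coh_classB // xc xc'.
  rewrite [LHS]E raddfB [LHS]coh_classB ?pr_cocycle //.
  by rewrite -!/(C j _) -(phiE c x xP xc) -(phiE c' x' x'P xc').
have [psi psiE] := zmod_morphism_additive phiB; exists psi.
apply: inj_surj_bijective => [|z].
  apply: raddf_inj => c; rewrite psiE; have [x xP <-] := coh_class_surj c => phi0.
  have exy j : exists y, y \in QJ j /\ dW y = pr j x.
    have C0 : C j (pr j x) = 0 by rewrite -(phiE (coh_class d P Q x) x xP erefl) phi0.
    by have [y Qy dy] := (coh_class_eq0 _ (pr_cocycle j xP)).1 C0; exists y.
  have [y yP] := choice exy.
  have [Px _] := cocycleP _ _ _ xP; have [s [us sP xE]] := pr_decomp Px.
  apply/coh_class_eq0 => //; exists (\sum_(j <- s) inc j (y j)).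
    by rewrite rpred_sum // => j _; apply: inc_Q; have [] := yP j.
  rewrite raddf_sum [RHS]xE; apply: eq_bigr => j _.
  by have [_ <-] := yP j; rewrite inc_d.
have exy j : exists y, y \in cocycles dW (PJ j) /\ C j y = ds_val z j.
  by have [y yP yc] := coh_class_surj (ds_val z j); exists y.
have [y yP] := choice exy; have [s sP] := direct_sum_support z.
have yPJ j : y j \in PJ j by have [/cocycleP[]] := yP j.
pose x := \sum_(j <- undup s) inc j (y j).
have xP : x \in cocycles d P.
  apply/cocycleP; split; first by rewrite rpred_sum // => j _; apply: inc_P.
  rewrite raddf_sum big1 // => j _; rewrite /= -inc_d.
  by have [/cocycleP[_ ->] _] := yP j; rewrite raddf0.
exists (coh_class d P Q x); rewrite psiE; apply/val_inj/functional_extensionality_dep => j.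
rewrite [LHS](phiE (coh_class d P Q x) x xP erefl) pr_sum ?undup_uniq //.
rewrite mem_undup; case: ifPn => [_|].
  by have [_] := yP j.
move/(contraNT (sP j)) => /eqP z0; rewrite [RHS]z0.
by apply/coh_class_eq0; [apply: rpred0 | exists 0; rewrite ?rpred0 ?raddf0].
Qed.

End Decomposition.

(** * The graded dimension of the ring Z[G] *)

Section Rank.
Variable V : zmodType.

Lemma int_indep_pred n (e : 'I_n.+1 -> V) :
  int_indep e -> exists e' : 'I_n -> V, int_indep e'.
Proof.
move=> eI; exists (fun i => e (lift ord_max i)) => c c0 i.
have := eI (fun j => if unlift ord_max j is Some k then c k else 0).
rewrite big_ord_recr /= unlift_none mulr0z addr0.
have E j : widen_ord (leqnSn n) j = lift ord_max j.
  by apply: val_inj; rewrite /= /bump leqNgt ltn_ord.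
under eq_bigr => j _ do rewrite E liftK.
by move=> /(_ c0)/(_ (lift ord_max i)); rewrite liftK.
Qed.

Lemma int_indep_le m n (e : 'I_n -> V) : (m <= n)%N -> int_indep e ->
  exists e' : 'I_m -> V, int_indep e'.
Proof.
elim: n e => [|n IH] e; first by rewrite leqn0 => /eqP -> eI; exists e.
rewrite leq_eqVlt => /orP[/eqP -> eI|]; first by exists e.
by rewrite ltnS => mn /int_indep_pred[e' /IH]; apply.
Qed.

Lemma rankZE n : has_rank V n -> rankZ V = n.
Proof.
move=> [[e eI] ne]; rewrite /rankZ; case: pselect => [ex|]; last first.
  by case; exists n; split => //; exists e.
case: (cid ex) => m [[e' e'I] ne'] /=.
case: (ltngtP m n) => // mn; [case: ne' | case: ne].
  exact: int_indep_le mn eI.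
exact: int_indep_le mn e'I.
Qed.

End Rank.

Section RingRank.
Variables (R : comPzRingType) (X : biquandle) (x0 : X) (beta : bracket X R).
Local Notation G := (grading_group x0 beta).
Local Notation S := (bracket_ring x0 beta).

Lemma ring_partP r (s : S) :
  reflect (forall g, s@_g != 0 -> val g = r) (s \in ring_part (x0 := x0) (beta := beta) r).
Proof.
apply: (iffP allP) => h g; first by rewrite mcoeff_neq0 => /h/eqP.
by rewrite -mcoeff_neq0 => /h ->.
Qed.

Lemma rank_graded_ring0 r : (forall g : G, val g <> r) -> rankZ (graded_ring x0 beta r) = 0%N.
Proof.
move=> rG; apply: rankZE; split.
  by exists (fun _ => 0) => c _ [].
case=> e /(_ (fun=> 1)); suff -> : e = fun => 0.
  by rewrite big1 => [|i _]; rewrite ?mul0rz // => /(_ erefl ord0).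
apply/funext => i; apply/val_inj/malgP => g /=.
rewrite mcoeff0; apply/eqP; apply: contraT => eg.
by case: (rG g); apply: (ring_partP _ _ (valP (e i))).
Qed.

(** The part of Z[G] in degree g is Z g: two elements with coefficients z and
    z' satisfy the relation with coefficients z' and - z, or z = 0. *)
Lemma rank_graded_ring1 (g : G) : rankZ (graded_ring x0 beta (val g)) = 1%N.
Proof.
pose V := graded_ring x0 beta (val g).
have coefE (v : V) : val v = << (val v : S)@_g *g g >> :> S.
  apply/malgP => h; rewrite mcoeffU; case: eqP => [<-//|gh].
  rewrite mulr0n; apply/eqP; apply: contraT => vh; case: gh.
  by apply: val_inj; apply/esym; apply: (ring_partP _ _ (valP v)).
have [|cf cfE] := @zmod_morphism_additive V int (fun v => (val v : S)@_g).
  by move=> u v; rewrite -mcoeffB -raddfB.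
have cf_eq0 v : cf v = 0 -> v = 0.
  by move=> v0; apply: val_inj; rewrite coefE -cfE v0 monalgU0 raddf0.
apply: rankZE; split.
  have uP : (<< 1 *g g >> : S) \in ring_part (x0 := x0) (beta := beta) (val g).
    by apply/ring_partP => h; rewrite mcoeffU; case: (g =P h) => [->|].
  exists (fun _ => SubGrp uP : V) => c.
  rewrite big_ord1 => /(congr1 cf); rewrite raddfMz raddf0 cfE /= mcoeffUU => c0 i.
  by rewrite [i]ord1 -c0 intz.
case=> e eI.
pose c (i : 'I_2) : int := if cf (e ord0) == 0 then (i == ord0)%:Z else
  if i == ord0 then cf (e ord_max) else - cf (e ord0).
have {}eI : forall i, c i = 0.
  apply: eI; apply: cf_eq0; rewrite big_ord_recl big_ord1 raddfD !raddfMz.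
  have -> : lift ord0 ord0 = ord_max :> 'I_2 by apply: val_inj.
  rewrite /c /=; case: eqP => [->|_].
    by rewrite mul0rz mulr0z addr0.
  by rewrite !mulrzz mulrN mulrC subrr.
have := eI ord_max; have := eI ord0; rewrite /c; case: eqP => //= z0 _ /eqP.
by rewrite oppr_eq0 => /eqP.
Qed.

End RingRank.

(** * The bracket complex as a sum of Khovanov complexes *)

Lemma cube_partP (D : diagram) (S : comNzRingType)
    (P : forall v : vertex D, labelling v -> zmodClosed S) i (x : cube D S) :
  x \in cube_part P i <->
  (forall v a, x v a \in P v a /\ (x v a != 0 -> homological_degree v = i)).
Proof.
split=> [/forallP h v a|h].
  by have /andP[xa /implyP xi] := forallP (h v) a; split=> // /xi/eqP.
by apply/forallP => v; apply/forallP => a; have [-> xi] := h v a; apply/implyP => /xi ->.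
Qed.

Lemma cube_diffE (D : diagram) (S : comNzRingType) (weight : 'I_(crossings D) -> S)
    (x : cube D S) v' (b : labelling v') :
  cube_diff weight x v' b
  = \sum_v \sum_(tau | is_edge v tau v')
      (-1) ^+ #|[pred sigma : 'I_(crossings D) | (sigma < tau)%N && v sigma]|
      * (weight tau * \sum_(a : labelling v | edge_coef tau a b) x v a).
Proof.
rewrite /cube_diff sum_ffunE; apply: eq_bigr => v _; rewrite sum_ffunE.
by apply: eq_bigr => tau _; rewrite !ffunE.
Qed.

Lemma mcoeff_translate (K : abelianGroupType) (u k : K) (s : group_ring K) :
  (((<< 1 *g u >> : group_ring K) * s) : group_ring K)@_(u * k)%g = s@_k.
Proof.
have -> : ((<< 1 *g u >> : group_ring K) * s) = \sum_(l <- msupp s) << s@_l *g (u * l)%g >>.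
  rewrite [X in _ * X]monalgE -[LHS]/(grmul _ _) grmul_sumr; apply: eq_bigr => l _.
  by rewrite grmulUU mul1r.
rewrite [in RHS](monalgE s) !raddf_sum /=; apply: eq_bigr => l _.
by rewrite !mcoeffU (inj_eq (mulgI u)).
Qed.

Lemma mulr_sign_odd (T : pzRingType) n (x : T) :
  (-1) ^+ n * x = if odd n then - x else x.
Proof. by rewrite -signr_odd mulr_sign. Qed.

Section Assembly.
Variables (R : comPzRingType) (X : biquandle) (x0 : X) (beta : bracket X R).
Variables (D : diagram) (f : coloring X D).
Local Notation G := (grading_group x0 beta).
Local Notation S := (bracket_ring x0 beta).
Local Notation q := (q0 x0 beta).
Local Notation W := (path_weight x0 beta f).
Local Notation c := (Z_coefficient x0 beta f).
Local Notation dS := (cube_diff (edge_weight x0 beta f)).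
Local Notation dZ := (@cube_diff D int (fun=> 1)).

Lemma path_weight_edge v tau v' : is_edge v tau v' ->
  W v' = (weight_group_elt x0 beta f tau * W v)%g.
Proof.
case/andP => vt /eqP ->; rewrite /path_weight (bigD1 tau) ?ffunE ?eqxx //=.
congr (_ * _)%g; apply: eq_bigl => s; rewrite ffunE.
by case: eqP => [->|]; rewrite ?andbT // (negbTE vt).
Qed.

(** The part in Khovanov degree [k] of the projection to the copy of [g]: in
    the copy of [g], the basis vector [a] at [v] is [g * W v] times that of the
    complex over S. *)
Definition copy_proj (g : G) (k : int) (x : cube D S) : cube D int := fun v =>
  [ffun a => if quantum_degree a == k then ((x v a : S)@_(g * W v)%g : int) else 0].

Fact copy_proj_additive g k : zmod_morphism (copy_proj g k).
Proof.
move=> x y; apply: functional_extensionality_dep => v; apply/ffunP => a.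
rewrite !ffunE; case: eqP => _; last by rewrite subrr.
by rewrite -mcoeffB; congr (_@_ _); rewrite !ffunE.
Qed.
HB.instance Definition _ g k :=
  GRing.isZmodMorphism.Build (cube D S) (cube D int) (copy_proj g k) (copy_proj_additive g k).

Definition copy_incl (g : G) (y : cube D int) : cube D S := fun v =>
  [ffun a => << (y v a : int) *g (g * W v)%g >> : S].

Fact copy_incl_additive g : zmod_morphism (copy_incl g).
Proof.
move=> x y; apply: functional_extensionality_dep => v; apply/ffunP => a.
by rewrite !ffunE -monalgUB; congr (<< _ *g _ >>); rewrite !ffunE.
Qed.
HB.instance Definition _ g :=
  GRing.isZmodMorphism.Build (cube D int) (cube D S) (copy_incl g) (copy_incl_additive g).

(** The rescaling by [W] absorbs the weights of the edges; the cut at degree [k]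
    commutes with the differential by [edge_degree]. *)
Lemma copy_proj_diff g k x : copy_proj g k (dS x) = dZ (copy_proj g k x).
Proof.
apply: functional_extensionality_dep => v'; apply/ffunP => b.
rewrite ffunE !cube_diffE.
transitivity (\sum_v \sum_(tau | is_edge v tau v')
  (-1) ^+ #|[pred sigma : 'I_(crossings D) | (sigma < tau)%N && v sigma]|
      * (if quantum_degree b == k
         then \sum_(a : labelling v | edge_coef tau a b) (x v a : S)@_(g * W v)%g
         else 0) : int).
  case: eqP => _; last first.
    by rewrite big1 // => v _; rewrite big1 // => tau _; rewrite mulr0.
  rewrite raddf_sum; apply: eq_bigr => v _ /=; rewrite raddf_sum; apply: eq_bigr => tau vv' /=.
  rewrite !mulr_sign_odd (path_weight_edge vv') abmulgCA.
  have E := mcoeff_translate (weight_group_elt x0 beta f tau) (g * W v)%g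
              (\sum_(a : labelling v | edge_coef tau a b) (x v a : S)).
  by case: (odd _); rewrite ?mcoeffN E raddf_sum.
apply: eq_bigr => v _; apply: eq_bigr => tau vv'; congr (_ * _); rewrite mul1r.
case: ifPn => kb; last rewrite big1 // => a ab.
  by apply: eq_bigr => a ab; rewrite ffunE (edge_degree vv' ab) kb.
by rewrite ffunE (edge_degree vv' ab) (negbTE kb).
Qed.

Lemma copy_incl_diff g y : copy_incl g (dZ y) = dS (copy_incl g y).
Proof.
apply: functional_extensionality_dep => v'; apply/ffunP => b.
rewrite ffunE !cube_diffE raddf_sum; apply: eq_bigr => v _ /=.
rewrite raddf_sum; apply: eq_bigr => tau vv' /=.
rewrite mul1r !mulr_sign_odd.
have <- : << (\sum_(a : labelling v | edge_coef tau a b) y v a : int) *g (g * W v')%g >>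
  = (edge_weight x0 beta f tau
     * \sum_(a : labelling v | edge_coef tau a b) (copy_incl g y v a : S)) :> S.
  rewrite mulr_sumr raddf_sum; apply: eq_bigr => a _ /=.
  rewrite ffunE -[RHS]/(grmul _ _) grmulUU mul1r.
  by rewrite (path_weight_edge vv') abmulgCA.
by case: (odd _); rewrite ?monalgUN.
Qed.

(** The rescaled form of [bracket_degreeE]. *)
Lemma degree_eq r g v (a : labelling v) :
  expgz q (quantum_degree a) = ((c * val g)^-1 * r)%g <->
  val (g * W v)%g = (r * (bracket_degree x0 beta f a)^-1)%g.
Proof.
have E := bracket_degreeE x0 beta f a.
have {}E : (val g * val (W v) * bracket_degree x0 beta f a
            = c * val g * expgz q (quantum_degree a))%g.
  by rewrite -mulgA [(val (W v) * _)%g]abmulgC E abmulgCA mulgA.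
rewrite valM; split=> [H|H]; first by rewrite H mulVKg in E; rewrite -E mulgK.
by rewrite H mulgVK in E; rewrite E mulKg.
Qed.

Definition bracket_part r v (a : labelling v) : zmodClosed S :=
  GRing.ZmodClosed.clone S (ring_part (r * (bracket_degree x0 beta f a)^-1)%g) _.

Definition Kh_part (k : int) v (a : labelling v) : zmodClosed int :=
  GRing.ZmodClosed.clone int (int_part (k - @quantum_degree D v a)) _.

Lemma copy_proj_part r g k i x :
  x \in cube_part (bracket_part r) i -> copy_proj g k x \in cube_part (Kh_part k) i.
Proof.
move/cube_partP => xP; apply/cube_partP => v a; have [xa xi] := xP v a.
rewrite ffunE; case: eqP => [<-|_]; last by rewrite rpred0 eqxx.
rewrite unfold_in /int_part subrr eqxx implybT; split=> // ne0; apply: xi.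
by apply: contraNneq ne0 => ->; rewrite mcoeff0.
Qed.

Lemma copy_incl_part r g k i y : expgz q k = ((c * val g)^-1 * r)%g ->
  y \in cube_part (Kh_part k) i -> copy_incl g y \in cube_part (bracket_part r) i.
Proof.
move=> gk /cube_partP yP; apply/cube_partP => v a; have [ya yi] := yP v a.
rewrite ffunE; split; last by rewrite monalgU_eq0.
apply/ring_partP => h; rewrite mcoeffU; case: (_ =P h) => [<-|]; last by rewrite eqxx.
rewrite mulr1n => y0; apply/degree_eq.
move: ya; rewrite unfold_in /int_part y0 subr_eq0 => /eqP <-; exact: gk.
Qed.

Lemma copy_proj_copy_incl g k g' k' i y : y \in cube_part (Kh_part k) i ->
  copy_proj g' k' (copy_incl g y) = if (g' == g) && (k' == k) then y else 0.
Proof.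
move/cube_partP => yP; apply: functional_extensionality_dep => v; apply/ffunP => a.
have [ya _] := yP v a; rewrite !ffunE mcoeffU (inj_eq (mulIg _)) (eq_sym g).
have ya0 : quantum_degree a != k -> y v a = 0.
  move: ya; rewrite unfold_in /int_part subr_eq0 => /implyP kE nk.
  by apply/eqP; apply: contraNT nk => /kE/eqP ->.
have [kk|kk] := eqVneq k' k; last first.
  rewrite andbF ffunE; case: eqP => // qk.
  by rewrite ya0 ?mul0rn // qk.
rewrite andbT kk; case: (g' == g); last by rewrite ffunE mulr0n; case: ifP.
by rewrite mulr1n; case: eqVneq => // /ya0 ->.
Qed.

Lemma copy_proj_eq0 r i x : x \in cube_part (bracket_part r) i ->
  (forall g k, expgz q k = ((c * val g)^-1 * r)%g -> copy_proj g k x = 0) -> x = 0.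
Proof.
move/cube_partP => xP x0'; apply: functional_extensionality_dep => v; apply/ffunP => a.
have [/ring_partP xa _] := xP v a; rewrite [RHS]ffunE; apply/malgP => h; rewrite mcoeff0.
apply/eqP; apply: contraT => ne0.
pose g := (h * (W v)^-1)%g; have hE : h = (g * W v)%g by rewrite mulgVK.
have := x0' g (quantum_degree a); rewrite degree_eq -hE => /(_ (xa h ne0)).
move/(congr1 (fun z : cube D int => z v a)); rewrite !ffunE eqxx -hE => E.
by rewrite E eqxx in ne0.
Qed.

Lemma copy_proj_finite (x : cube D S) :
  exists s : seq (G * int), forall g k, copy_proj g k x != 0 -> (g, k) \in s.
Proof.
exists (flatten [seq flatten
   [seq [seq ((h * (W v)^-1)%g, quantum_degree a) | h <- msupp (x v a : S)]
   | a <- enum {: labelling v}] | v <- enum {: vertex D}]).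
move=> g k; apply: contraR => gk; apply/eqP.
apply: functional_extensionality_dep => v; apply/ffunP => a.
rewrite !ffunE; case: eqP => // ka; apply/eqP; apply: contraR gk; rewrite mcoeff_neq0 => xa.
apply/flatten_mapP; exists v; first by rewrite mem_enum.
apply/flatten_mapP; exists a; first by rewrite mem_enum.
by apply/mapP; exists (g * W v)%g; rewrite // mulgK ka.
Qed.

Section Index.
Variable r : units R.

(** The indices of the direct sums in the target: [tag hj] is a term of the
    formal sum Z_beta(f), hence c g for a unique g in G. *)
Definition copy_index : eqType :=
  {hj : {h : units R & 'I_(Z_beta x0 beta f h)}
   & {k : int | expgz q k == ((tag hj)^-1 * r)%g}}.

Lemma Z_beta_elt h : (Z_beta x0 beta f h != 0)%N -> exists g : G, (c * val g)%g = h.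
Proof.
move=> F0; have [[g gE]|ng] := pselect (exists g : G, val g = (c^-1 * h)%g).
  by exists g; rewrite gE mulVKg.
case/eqP: F0; apply: rank_graded_ring0 => g gE; case: ng; exists g; exact: gE.
Qed.

Lemma Z_beta1 (g : G) : Z_beta x0 beta f (c * val g)%g = 1%N.
Proof.
rewrite -[LHS]/(rankZ (graded_ring x0 beta (c^-1 * (c * val g)))%g) mulKg.
exact: rank_graded_ring1.
Qed.

Lemma copy_index_elt (p : copy_index) : exists g : G, (c * val g)%g = tag (tag p).
Proof.
apply: Z_beta_elt; case: p => -[h j] _ /=.
by apply/eqP => F0; case: j; rewrite F0.
Qed.

Definition index_elt p : G := sval (cid (copy_index_elt p)).
Definition index_deg (p : copy_index) : int := val (tagged p).

Lemma index_eltE p : (c * val (index_elt p))%g = tag (tag p).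
Proof. exact: svalP (cid (copy_index_elt p)). Qed.

Lemma index_degE p : expgz q (index_deg p) = ((c * val (index_elt p))^-1 * r)%g.
Proof. by rewrite index_eltE; apply/eqP/(valP (tagged p)). Qed.

(** Z_beta(f) has multiplicity 1 at each of its terms ([Z_beta1]). *)
Lemma index_inj : injective (fun p => (index_elt p, index_deg p)).
Proof.
move=> p p' [gE kE]; have := index_eltE p; have := index_eltE p'; rewrite -{}gE.
move: (index_elt p) kE => g; rewrite /index_deg.
case: p p' => [[h j] k] [[h' j'] k'] /= kk' E E'; move: j k j' k' kk'.
rewrite -E -E' => j k j' k' kk'.
have jj' : j = j' by move: (Z_beta1 g) j j' {k k' kk'} => -> j j'; rewrite !ord1.
rewrite -jj' in k' kk' *; congr Tagged; exact: val_inj.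
Qed.

Lemma index_surj g k : expgz q k = ((c * val g)^-1 * r)%g ->
  exists p, index_elt p = g /\ index_deg p = k.
Proof.
move=> gk; have j : 'I_(Z_beta x0 beta f (c * val g)%g) by rewrite Z_beta1; exact: ord0.
pose hj : {h : units R & 'I_(Z_beta x0 beta f h)} := Tagged _ j.
have kP : expgz q k == ((tag hj)^-1 * r)%g by apply/eqP.
exists (Tagged _ (exist _ k kP)); split=> //.
by apply/val_inj/(@mulgI _ c); rewrite index_eltE.
Qed.

End Index.

End Assembly.

Theorem theorem1 (R : comPzRingType) (X : biquandle) (x0 : X)
    (beta : bracket X R) (D : diagram) (f : coloring X D) (i : int) :
  graded_iso (H_beta x0 beta f i)
             (shift_sum (Kh_beta x0 beta D i) (Z_beta x0 beta f)).
Proof.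
move=> r.
pose J := copy_index x0 beta f r.
pose g (p : J) := index_elt p; pose k (p : J) := index_deg p.
have [] := @cohomology_direct_sum _ _ (cube_diff (edge_weight x0 beta f))
  (@cube_diff D int (fun=> 1))
  (GRing.ZmodClosed.clone _ (cube_part (bracket_part x0 beta f r) i) _)
  (GRing.ZmodClosed.clone _ (cube_part (bracket_part x0 beta f r) (i - 1)) _)
  J
  (fun p => GRing.ZmodClosed.clone _ (cube_part (Kh_part (D := D) (k p)) i) _)
  (fun p => GRing.ZmodClosed.clone _ (cube_part (Kh_part (D := D) (k p)) (i - 1)) _)
  (fun p => copy_proj f (g p) (k p)) (fun p => copy_incl f (g p)).
- by move=> p x; apply: copy_proj_part.
- by move=> p x; apply: copy_proj_part.
- by move=> p y; apply: copy_incl_part; apply: index_degE.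
- by move=> p y; apply: copy_incl_part; apply: index_degE.
- by move=> p x; apply: copy_proj_diff.
- by move=> p y; apply: copy_incl_diff.
- move=> p p' y yP; rewrite [LHS](copy_proj_copy_incl f (g p) (g p') (k p') yP).
  by rewrite -xpair_eqE (inj_eq (@index_inj _ _ _ _ _ _ _)).
- move=> x xP x0'; apply: (copy_proj_eq0 xP) => g' k' /index_surj[p [<- <-]]; exact: x0'.
- move=> x; have [s sP] := copy_proj_finite f x.
  have [t tP] := finite_preimage s (@index_inj _ _ x0 beta _ f r).
  by exists t => p /sP; apply: tP.
move=> phi phi_bij.
have [psi psi_bij] := @direct_sum_curry _ 
   (fun hj : {h : units R & 'I_(Z_beta x0 beta f h)} => 
     {k : int | expgz (q0 x0 beta) k == ((tag hj)^-1 * r)%g} : eqType)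
   (fun _ k => Kh D i (val k)).
exists (psi \o phi); exact: bij_comp.
Qed.
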